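(* Let $\mathcal D$ be a brane diagram, $S$ a tie diagram of $\mathcal D$, and $f=f_S\in\mathcal C(\mathcal D)^{\mathbb T}$ the fixed point represented by the corresponding butterfly diagram. For every D3 brane $X$, the restriction map $K_{\mathbb T}(\mathcal C(\mathcal D))\to K_{\mathbb T}(f)=\mathbb C[\mathbf u_1^{\pm1},\dots,\mathbf u_n^{\pm1},\mathbf h^{\pm1}]$ maps the Grothendieck roots (K-theoretic Chern roots) of the tautological bundle $\xi_X$ to the monomials associated with the dots of the butterfly diagram directly below $X$; i.e. $\xi_X|_f$ is the sum, over all dots below $X$ in all butterflies, of their monomials.
   Context: **Brane diagrams.** A brane diagram $\mathcal D$ is a finite sequence of 5-branes arranged from left to right, each being either a D5 brane or an NS5 brane. The D3 branes are the intervals between consecutive 5-branes, together with one D3 brane to the left of all 5-branes and one to the right of all of them. Each D3 brane $X$ carries a multiplicity $d_X\in\mathbb Z_{\ge0}$; the two outer D3 branes have multiplicity $0$. The D5 branes are $U_1,\dots,U_n$ and the NS5 branes are $V_1,\dots,V_m$, numbered left to right. For a 5-brane $W$, $W^-$ and $W^+$ are the D3 branes directly left and right of it; for a D3 brane $X$, $X^-$ and $X^+$ are the 5-branes directly left and right of it. Put $\mathrm{charge}(V)=d_{V^+}-d_{V^-}+\#\{\text{D5 branes left of }V\}$ for NS5 branes and $\mathrm{charge}(U)=d_{U^-}-d_{U^+}+\#\{\text{NS5 branes right of }U\}$ for D5 branes; $r_i=\mathrm{charge}(V_i)$, $c_j=\mathrm{charge}(U_j)$. Standing assumption, part of the definition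 of brane diagram: there is at least one $m\times n$ matrix with entries in $\{0,1\}$ with row sums $r$ and column sums $c$. **Bow variety.** For each D3 brane $X$ let $W_X$ be a complex vector space of dimension $d_X$; for each D5 brane $U$ let $\mathbb C_U$ be a one-dimensional vector space. Let $\mathbb M_U=\mathrm{Hom}(W_{U^+},W_{U^-})\oplus\mathrm{Hom}(W_{U^+},\mathbb C_U)\oplus\mathrm{Hom}(\mathbb C_U,W_{U^-})\oplus\mathrm{End}(W_{U^-})\oplus\mathrm{End}(W_{U^+})\ni(A_U,b_U,a_U,B_U,B'_U)$ for D5 branes $U$, $\mathbb M_V=\mathrm{Hom}(W_{V^+},W_{V^-})\oplus\mathrm{Hom}(W_{V^-},W_{V^+})\ni(C_V,D_V)$ for NS5 branes $V$, and $\mathbb M=\bigoplus_U\mathbb M_U\oplus\bigoplus_V\mathbb M_V$. Let $\mathbb N=\bigoplus_{U}\mathrm{Hom}(W_{U^+},W_{U^-})\oplus\bigoplus_{X}\mathrm{End}(W_X)$. The moment map $\mu:\mathbb M\to\mathbb N$ has $U$-component $B_UA_U-A_UB'_U+a_Ub_U$, and $X$-component: $B'_{X^-}-B_{X^+}$ if $X^-,X^+$ are both D5; $C_{X^+}D_{X^+}-D_{X^-}C_{X^-}$ if both are NS5; $-D_{X^-}C_{X^-}-B_{X^+}$ if $X^-$ is NS5 and $X^+$ is D5; $C_{X^+}D_{X^+}+B'_{X^-}$ if $X^-$ is D5 and $X^+$ is NS5. Let $\widetilde{\mathcal M}$ be the set of points of $\mu^{-1}(0)$ such that for every D5 brane $U$: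 (S1) if $S\le W_{U^+}$ with $B'_U(S)\subset S$, $A_U(S)=0$, $b_U(S)=0$ then $S=0$; (S2) if $T\le W_{U^-}$ with $B_U(T)\subset T$, $\mathrm{Im}A_U+\mathrm{Im}\,a_U\subset T$ then $T=W_{U^-}$. Let $\mathcal G=\prod_X\mathrm{GL}(W_X)$ act naturally on $\mathbb M$, and let $\chi:\mathcal G\to\mathbb C^\times$, $\chi((g_X)_X)=\prod_{X'}\det g_{X'}$, the product over D3 branes $X'$ for which $X'^-$ is an NS5 brane. Let $\mathcal G$ act on $\widetilde{\mathcal M}\times\mathbb C$ by $g.(m,z)=(gm,\chi^{-1}(g)z)$. Then $m\in\widetilde{\mathcal M}$ is stable, $m\in\widetilde{\mathcal M}^s$, if for $z\ne0$ the orbit $\mathcal G(m,z)$ is closed and the stabilizer of $(m,z)$ is finite. The bow variety is $\mathcal C(\mathcal D)=\widetilde{\mathcal M}^s/\mathcal G$ (a smooth variety). **Torus action and tautological bundles.** $\mathbb A=(\mathbb C^\times)^{\{\text{D5 branes}\}}$ acts by rescaling the lines $\mathbb C_U$, so an element $(t_U)_U$ sends $a_U\mapsto t_U^{-1}a_U$, $b_U\mapsto t_Ub_U$. The torus $\mathbb C^\times_\hbar$ acts on $\mathbb M$ by multiplying all $B_U,B'_U,b_U,C_V$ by the scalar $\hbar$ and fixing all $A_U,a_U,D_V$. Both descend to $\mathcal C(\mathcal D)$; $\mathbb T=\mathbb A\times\mathbb C^\times_\hbar$. Let $\mathbf u_j\in K_{\mathbb T}(\mathrm{pt})$ be the class of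 $\mathbb C_{U_j}$, i.e. the standard character of the $j$th component of $\mathbb A$, and $\mathbf h\in K_{\mathbb T}(\mathrm{pt})$ the standard character of $\mathbb C^\times_\hbar$. The tautological bundle $\xi_X=\widetilde{\mathcal M}^s\times_{\mathcal G}W_X$ has rank $d_X$ and is $\mathbb T$-equivariant via the action of $\mathbb T$ on the first factor. **Tie diagrams.** A tie diagram of $\mathcal D$ is a set $S$ of pairs (ties), each consisting of one D5 and one NS5 brane, such that each D3 brane $X$ is covered by (lies between the two members of) exactly $d_X$ of the pairs. **Butterfly diagrams.** Given a tie diagram $S$ and a D5 brane $U$, let $n_U(X)$ be the number of ties of $S$ that contain $U$ and cover $X$, and let $l=n_U(U^-)$, $\rho=n_U(U^+)$. The butterfly of $U$ has, below each D3 brane $X$, a column of $n_U(X)$ dots at consecutive integer heights with top height $t_U(X)$ (so heights $t_U(X)-n_U(X)+1,\dots,t_U(X)$), where $t_U(X)=\rho-l$ if $X$ is to the right of $U$, and $t_U(X)=-\#\{\text{NS5 branes between }X\text{ and }U\}$ if $X$ is to the left of $U$. (Height $0$ is the base level.) The butterfly diagram is the disjoint union of the butterflies of all D5 branes. Take $W_X$ to have as basis the dots below $X$ in all butterflies (there are $d_X$ of them). Define $m_S\in\mathbb M$ as the tuple acting within each butterfly as follows (an image is $0$ if the named dot does not exist): $A_{U'}$ sends the dot at height $s$ below $U'^+$ to the dot at height $s$ below $U'^-$ (any D5 brane $U'$); $-B_{U'}$ and $-B'_{U'}$ send the dot at height $s$ to the dot at height $s-1$ in the same column; $C_V$ sends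 the dot at height $s$ below $V^+$ to the dot at height $s-1$ below $V^-$; $D_V$ sends the dot at height $s$ below $V^-$ to the dot at height $s$ below $V^+$. Finally $a_U$ sends a generator $1\in\mathbb C_U$ to the top dot (height $0$) below $U^-$ in the butterfly of $U$ (and $a_U=0$ if $l=0$), and $-b_U$ sends the dot at height $1$ below $U^+$ in the butterfly of $U$, if it exists, to $1\in\mathbb C_U$, and all other dots to $0$. The tuple $m_S$ lies in $\widetilde{\mathcal M}^s$, its class $f_S$ is $\mathbb T$-fixed, and every $\mathbb T$ fixed point arises this way. **Monomials.** The monomial associated with a dot at height $s$ in the butterfly of $U_j$ is $\mathbf u_j\mathbf h^s$. *)

(* Defs.v *)
From HB Require Import structures.
From mathcomp Require Import all_boot all_order all_algebra.
From mathcomp Require Import complex.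
From mathcomp Require Import boolp classical_sets functions cardinality reals.

Set Implicit Arguments.
Unset Strict Implicit.
Unset Printing Implicit Defensive.

Import Order.TTheory GRing.Theory Num.Theory.

Local Open Scope classical_set_scope.
Local Open Scope ring_scope.

Inductive fivebrane := D5brane | NS5brane.

Definition isD5 (b : fivebrane) : bool := if b is D5brane then true else false.

(* The 5-branes are at positions 0, ..., N-1 (N = size branes), the D3 branes
   at positions 0, ..., N; the 5-brane at position i lies between the D3 branes
   at positions i and i.+1. *)
Record brane_data := BraneData {
  branes : seq fivebrane;
  mults : seq nat;
  size_mults : size mults = (size branes).+1;
  mults_first : nth 0%N mults 0 = 0%N;
  mults_last : nth 0%N mults (size branes) = 0%N
}.

Section Branes.
Variable D : brane_data.

Definition D5at (k : nat) : bool :=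
  (k < size (branes D))%N && isD5 (nth NS5brane (branes D) k).
Definition NS5at (k : nat) : bool :=
  (k < size (branes D))%N && ~~ isD5 (nth D5brane (branes D) k).

Definition D5 : Type := {i : 'I_(size (branes D)) | D5at i}.
Definition NS5 : Type := {i : 'I_(size (branes D)) | NS5at i}.
Definition D3 : Type := 'I_(size (branes D)).+1.

Definition posU (U : D5) : nat := val (val U).
Definition posV (V : NS5) : nat := val (val V).
Definition posX (X : D3) : nat := val X.

Definition mkD5 (k : nat) (h : D5at k) : D5 :=
  exist _ (Ordinal (proj1 (andP h))) h.
Definition mkNS5 (k : nat) (h : NS5at k) : NS5 :=
  exist _ (Ordinal (proj1 (andP h))) h.

Definition leftX (i : 'I_(size (branes D))) : D3 :=
  Ordinal (ltnW (ltn_ord i : (i.+1 < (size (branes D)).+1)%N)).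
Definition rightX (i : 'I_(size (branes D))) : D3 :=
  Ordinal (ltn_ord i : (i.+1 < (size (branes D)).+1)%N).

(* W^- and W^+ for a D5 brane (U) and an NS5 brane (V). *)
Definition Um (U : D5) : D3 := leftX (val U).
Definition Up (U : D5) : D3 := rightX (val U).
Definition Vm (V : NS5) : D3 := leftX (val V).
Definition Vp (V : NS5) : D3 := rightX (val V).

Definition mult (X : D3) : nat := nth 0%N (mults D) (posX X).

Definition chargeV (V : NS5) : int :=
  (mult (Vp V))%:Z - (mult (Vm V))%:Z + (#|[pred U : D5 | (posU U < posV V)%N]|)%:Z.
Definition chargeU (U : D5) : int :=
  (mult (Um U))%:Z - (mult (Up U))%:Z + (#|[pred V : NS5 | (posU U < posV V)%N]|)%:Z.

Definition has_binary_table : Prop :=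
  exists b : NS5 -> D5 -> bool,
    (forall V, \sum_(U : D5) (b V U : nat)%:Z = chargeV V) /\
    (forall U, \sum_(V : NS5) (b V U : nat)%:Z = chargeU U).

End Branes.

Record brane_diagram := BraneDiagram {
  diagram_data :> brane_data;
  binary_tableP : has_binary_table diagram_data
}.

(* W_X is C^(d_X), written as column vectors; Hom(W_X, W_Y) is 'M_(d_Y, d_X). *)
Section BowVariety.
Variables (R : realType) (D : brane_diagram).
Local Notation C := R[i].

Record rep := Rep {
  mA : forall U : D5 D, 'M[C]_(mult (Um U), mult (Up U));
  mb : forall U : D5 D, 'rV[C]_(mult (Up U));
  ma : forall U : D5 D, 'cV[C]_(mult (Um U));
  mB : forall U : D5 D, 'M[C]_(mult (Um U));
  mB' : forall U : D5 D, 'M[C]_(mult (Up U));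
  mC : forall V : NS5 D, 'M[C]_(mult (Vm V), mult (Vp V));
  mD : forall V : NS5 D, 'M[C]_(mult (Vp V), mult (Vm V))
}.

(* The components of mu = 0 at the D3 brane X at position k.+1, whose
   neighbours X^- and X^+ are the 5-branes at positions k and k.+1.
   The two outer D3 branes contribute End(0) = 0. *)
Definition moment_zero (m : rep) : Prop :=
  [/\ forall U : D5 D,
        mB m U *m mA m U - mA m U *m mB' m U + ma m U *m mb m U = 0,
      forall k (h : D5at D k) (h' : D5at D k.+1),
        mB' m (mkD5 h) - mB m (mkD5 h') = 0,
      forall k (h : NS5at D k) (h' : NS5at D k.+1),
        mC m (mkNS5 h') *m mD m (mkNS5 h')
        - mD m (mkNS5 h) *m mC m (mkNS5 h) = 0,
      forall k (h : NS5at D k) (h' : D5at D k.+1),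
        - (mD m (mkNS5 h) *m mC m (mkNS5 h)) - mB m (mkD5 h') = 0
    & forall k (h : D5at D k) (h' : NS5at D k.+1),
        mC m (mkNS5 h') *m mD m (mkNS5 h') + mB' m (mkD5 h) = 0].

Definition S1 (m : rep) (U : D5 D) : Prop :=
  forall S : {vspace 'cV[C]_(mult (Up U))},
    (forall v, v \in S -> mB' m U *m v \in S) ->
    (forall v, v \in S -> mA m U *m v = 0) ->
    (forall v, v \in S -> mb m U *m v = 0) ->
    S = 0%VS.

Definition S2 (m : rep) (U : D5 D) : Prop :=
  forall T : {vspace 'cV[C]_(mult (Um U))},
    (forall v, v \in T -> mB m U *m v \in T) ->
    (forall (v : 'cV[C]_(mult (Up U))) (z : 'cV[C]_1),
        mA m U *m v + ma m U *m z \in T) ->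
    T = fullv.

Definition Mtilde : set rep :=
  [set m | moment_zero m /\ forall U, S1 m U /\ S2 m U].

Definition gauge_group : set (forall X : D3 D, 'M[C]_(mult X)) :=
  [set g | forall X, g X \in unitmx].

Definition gauge_act (g : forall X : D3 D, 'M[C]_(mult X)) (m : rep) : rep :=
  Rep (fun U => g (Um U) *m mA m U *m invmx (g (Up U)))
      (fun U => mb m U *m invmx (g (Up U)))
      (fun U => g (Um U) *m ma m U)
      (fun U => g (Um U) *m mB m U *m invmx (g (Um U)))
      (fun U => g (Up U) *m mB' m U *m invmx (g (Up U)))
      (fun V => g (Vm V) *m mC m V *m invmx (g (Vp V)))
      (fun V => g (Vp V) *m mD m V *m invmx (g (Vm V))).

(* The D3 branes X' whose X'^- is an NS5 brane V are exactly the V^+. *)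
Definition chi (g : forall X : D3 D, 'M[C]_(mult X)) : C :=
  \prod_(V : NS5 D) \det (g (Vp V)).

Definition gauge_act_z (g : forall X : D3 D, 'M[C]_(mult X)) (p : rep * C) :
  rep * C := (gauge_act g p.1, (chi g)^-1 * p.2).

(* Polynomial functions on the affine space M x C. *)
Inductive polyfun : (rep * C -> C) -> Prop :=
| pf_const c : polyfun (fun=> c)
| pf_z : polyfun (fun p => p.2)
| pf_A U i j : polyfun (fun p => mA p.1 U i j)
| pf_b U i j : polyfun (fun p => mb p.1 U i j)
| pf_a U i j : polyfun (fun p => ma p.1 U i j)
| pf_B U i j : polyfun (fun p => mB p.1 U i j)
| pf_B' U i j : polyfun (fun p => mB' p.1 U i j)
| pf_C V i j : polyfun (fun p => mC p.1 V i j)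
| pf_D V i j : polyfun (fun p => mD p.1 V i j)
| pf_add f g : polyfun f -> polyfun g -> polyfun (fun p => f p + g p)
| pf_mul f g : polyfun f -> polyfun g -> polyfun (fun p => f p * g p).

Definition zariski_closed_in (Y Z : set (rep * C)) : Prop :=
  exists2 F : set (rep * C -> C), F `<=` polyfun &
    Z = Y `&` [set p | forall f, F f -> f p = 0].

Definition stable : set rep :=
  [set m | Mtilde m /\
    forall z : C, z != 0 ->
      zariski_closed_in (Mtilde `*` setT)
        [set gauge_act_z g (m, z) | g in gauge_group] /\
      finite_set (gauge_group `&` [set g | gauge_act_z g (m, z) = (m, z)])].

(* Points of quotients are represented by the orbits themselves. *)
Definition bow_class (m : rep) : set rep :=
  [set gauge_act g m | g in gauge_group].

Definition bow_variety : set (set rep) := [set bow_class m | m in stable].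

Section Tautological.
Variable X : D3 D.

Definition taut_class (p : rep * 'cV[C]_(mult X)) :
    set (rep * 'cV[C]_(mult X)) :=
  [set (gauge_act g p.1, g X *m p.2) | g in gauge_group].

Definition taut_total : set (set (rep * 'cV[C]_(mult X))) :=
  [set taut_class p | p in stable `*` setT].

Definition taut_proj (e : set (rep * 'cV[C]_(mult X))) : set rep :=
  [set p.1 | p in e].

Definition taut_fiber (f : set rep) : set (set (rep * 'cV[C]_(mult X))) :=
  taut_total `&` [set e | taut_proj e = f].

(* [m, w] + [m, w'] = [m, w + w'] and c [m, w] = [m, c w]. *)
Definition fiber_add (e e' : set (rep * 'cV[C]_(mult X))) :
    set (rep * 'cV[C]_(mult X)) :=
  [set p | exists w w', [/\ e (p.1, w), e' (p.1, w') & p.2 = w + w']].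

Definition fiber_scale (c : C) (e : set (rep * 'cV[C]_(mult X))) :
    set (rep * 'cV[C]_(mult X)) :=
  [set (p.1, c *: p.2) | p in e].

End Tautological.

(* Points of the torus T = A x C^*_h. *)
Record torus := Torus {
  tu : D5 D -> C;
  th : C;
  tu_neq0 : forall U, tu U != 0;
  th_neq0 : th != 0
}.

Definition torus_act (t : torus) (m : rep) : rep :=
  Rep (mA m)
      (fun U => (th t * tu t U) *: mb m U)
      (fun U => (tu t U)^-1 *: ma m U)
      (fun U => th t *: mB m U)
      (fun U => th t *: mB' m U)
      (fun V => th t *: mC m V)
      (mD m).

Definition torus_act_bow (t : torus) (f : set rep) : set rep :=
  [set torus_act t m | m in f].

Definition torus_act_taut (X : D3 D) (t : torus)
    (e : set (rep * 'cV[C]_(mult X))) : set (rep * 'cV[C]_(mult X)) :=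
  [set (torus_act t p.1, p.2) | p in e].

Definition bow_fixed : set (set rep) :=
  bow_variety `&` [set f | forall t, torus_act_bow t f = f].

(* K_T(pt) = C[u_1^{+-1}, ..., u_n^{+-1}, h^{+-1}] is identified with the
   Laurent polynomial functions T -> C; the class of a representation is its
   character. *)
Definition KT_pt : Type := torus -> C.

Definition KT_class (n : nat) (rho : torus -> 'M[C]_n) : KT_pt :=
  fun t => \tr (rho t).

(* xs are the Grothendieck roots of rho: the class of the k-th exterior power
   of rho is the k-th elementary symmetric function of xs, for every k. *)
Definition KT_roots (n : nat) (rho : torus -> 'M[C]_n) (xs : seq KT_pt) : Prop :=
  forall t, char_poly (rho t) = \prod_(x <- xs) ('X - (x t)%:P).

(* phi is a linear isomorphism from C^n to the fibre of xi_X at f, in which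
   the action of T on the fibre has the matrices rho. *)
Definition taut_frame (X : D3 D) (f : set rep) (n : nat)
    (phi : 'cV[C]_n -> set (rep * 'cV[C]_(mult X)))
    (rho : torus -> 'M[C]_n) : Prop :=
  [/\ set_bij setT (@taut_fiber X f) phi,
      forall v w, phi (v + w) = fiber_add (phi v) (phi w),
      forall c v, phi (c *: v) = fiber_scale c (phi v)
    & forall t v, torus_act_taut t (phi v) = phi (rho t *m v)].

(* The T-representation xi_X|_f, written as matrices in some basis of the
   fibre; other bases give conjugate matrices, hence the same class and roots. *)
Definition taut_restriction (X : D3 D) (f : set rep) (n : nat)
    (rho : torus -> 'M[C]_n) : Prop :=
  exists phi, taut_frame (X := X) f phi rho.

End BowVariety.

Section Ties.
Variable D : brane_diagram.

Definition covers (X : D3 D) (p : D5 D * NS5 D) : bool :=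
  ((posU p.1 < posX X <= posV p.2) || (posV p.2 < posX X <= posU p.1))%N.

Record tie_diagram := TieDiagram {
  ties : {set D5 D * NS5 D};
  tiesP : forall X : D3 D, #|[pred p in ties | covers X p]| = mult X
}.

Variable S : tie_diagram.

Definition ncover (U : D5 D) (X : D3 D) : nat :=
  #|[pred p in ties S | (p.1 == U) && covers X p]|.

Definition top (U : D5 D) (X : D3 D) : int :=
  if (posU U < posX X)%N
  then (ncover U (Up U))%:Z - (ncover U (Um U))%:Z
  else - (#|[pred V : NS5 D | (posX X <= posV V < posU U)%N]|)%:Z.

Definition column (U : D5 D) (X : D3 D) : seq int :=
  [seq top U X - k%:Z | k <- iota 0 (ncover U X)].

(* A dot below X: the D5 brane of its butterfly, and its height. *)
Definition dots (X : D3 D) : seq (D5 D * int) :=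
  [seq (U, s) | U <- enum {: D5 D}, s <- column U X].

Lemma size_dots (X : D3 D) : size (dots X) == mult X.
Proof.
rewrite size_allpairs_dep sumnE big_map big_enum /= -(tiesP S X).
rewrite -sum1_card (partition_big fst xpredT) //=; apply/eqP.
apply: eq_bigr => U _; rewrite size_map size_iota /ncover -sum1_card.
by apply: eq_bigl => p; rewrite !inE -andbA [_ && covers _ _]andbC.
Qed.

Definition dot (X : D3 D) (i : 'I_(mult X)) : D5 D * int :=
  tnth (Tuple (size_dots X)) i.

Variable R : realType.
Local Notation C := R[i].

(* The matrices of m_S in the bases of dots: column j is the image of the
   j-th dot. *)
Definition same_dot (X Y : D3 D) : 'M[C]_(mult Y, mult X) :=
  \matrix_(i, j) (dot i == dot j)%:R.

Definition lower_dot (X Y : D3 D) : 'M[C]_(mult Y, mult X) :=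
  \matrix_(i, j) (dot i == ((dot j).1, (dot j).2 - 1))%:R.

Definition butterfly_point : rep R D :=
  Rep (fun U => same_dot (Up U) (Um U))
      (fun U => \row_j - (dot j == (U, 1))%:R)
      (fun U => \col_i (dot i == (U, 0))%:R)
      (fun U => - lower_dot (Um U) (Um U))
      (fun U => - lower_dot (Up U) (Up U))
      (fun V => lower_dot (Vp V) (Vm V))
      (fun V => same_dot (Vm V) (Vp V)).

Definition fixed_point : set (rep R D) := bow_class butterfly_point.

Definition monomial (p : D5 D * int) : KT_pt R D :=
  fun t => tu t p.1 * th t ^ p.2.

End Ties.

Arguments fixed_point {D} S R.
Arguments monomial {D} R p.

(* Main.v *)
Require Import Defs.
From mathcomp Require Import all_boot all_order all_algebra.
From mathcomp Require Import complex zify ring.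
From mathcomp Require Import boolp classical_sets functions cardinality reals.

(** Let [m] be the butterfly representation. A torus element scales each of its
    arrows, and each arrow sends dots to dots, so the diagonal matrix with the
    inverse monomials on the diagonal is a gauge transformation that moves [m]
    in the same way ([torus_act_butterfly]). The class of [m] is therefore
    fixed, and on the fibre of the tautological bundle, identified with [W_X]
    by the representatives over [m], the torus acts by the diagonal matrix of
    monomials ([taut_frame_class]); its trace and its characteristic polynomial
    are the two formulas of the theorem.

    What takes work is that [m] is a point of the bow variety, with trivial
    stabilizer. The moment map equations and the two stability conditions at
    D5 branes are checked on dots; they only depend on how the two ends of a
    column move when a 5-brane is crossed ([dots_D5], [column_step]). For the
    rest, consider the linear system whose unknown is a morphism from [m] to a
    variable point [p]. If [p] satisfies (S1), the solution is unique: a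
    homogeneous solution vanishes on every dot, by following each butterfly
    from its top dot at the framing through its left wing and then through its
    right wing ([butterfly_rigid]). Uniqueness at [p = m] says that the
    stabilizer is trivial.

    Uniqueness also gives closed orbits ([orbit_closed]). By Cramer's rule the solution is a regular
    function of [p] near any point [p0] of the closure of the orbit, so a
    solution exists at [p0], and the algebraic relation between the character
    of the solution and the coordinate [z] persists there. This relation makes
    the solution invertible to the right of every NS5 brane; (S1) for [m]
    makes it invertible to the right of every D5 brane ([morphism_unit]). Hence
    it is a gauge transformation carrying [m] to [p0]. *)

Set Implicit Arguments.
Unset Strict Implicit.
Unset Printing Implicit Defensive.

Import Order.TTheory GRing.Theory Num.Theory.

Local Open Scope classical_set_scope.
Local Open Scope ring_scope.

(** * Matrices over a field *)

Section Matrices.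
Variable F : fieldType.

Lemma unitmx_left_inj n (A : 'M[F]_n) :
  (forall v : 'cV_n, A *m v = 0 -> v = 0) -> A \in unitmx.
Proof.
move=> injA; rewrite -unitmx_tr -row_free_unit -kermx_eq0.
apply/eqP/row_matrixP => i; rewrite row0; apply: trmx_inj; rewrite trmx0.
by apply: injA; rewrite -{1}[A]trmxK -trmx_mul -row_mul mulmx_ker row0 trmx0.
Qed.

Lemma linear_fun_delta n (f : 'rV[F]_n -> F) :
  (forall c x y, f (c *: x + y) = c * f x + f y) ->
  forall x, f x = \sum_j x 0 j * f (delta_mx 0 j).
Proof.
move=> lin_f x.
have f0 : f 0 = 0.
  by have := lin_f (-1) 0 0; rewrite scaler0 addr0 mulN1r addNr.
rewrite {1}(row_sum_delta x).
elim/big_rec2: _ => [|j y z _ <-]; first exact: f0.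
by rewrite lin_f.
Qed.

End Matrices.

(** * Gauge action and morphisms of representations *)

Section Gauge.
Variables (R : realType) (D : brane_diagram).
Local Notation C := R[i].
Implicit Types (m : rep R D) (g h phi : forall X : D3 D, 'M[C]_(mult X)).

Lemma brane_cases k : (k < size (branes D))%N -> D5at D k \/ NS5at D k.
Proof.
rewrite /D5at /NS5at => hk; rewrite hk /= (set_nth_default NS5brane) //.
by case: isD5; [left | right].
Qed.

(** The conditions defining a point of Hom between two representations of the
    quiver, except that the framing lines are related by the scalar [lam] and
    not necessarily by the identity: [lam = 1] gives the maps that a gauge
    transformation induces, and differences of those have [lam = 0]. *)
Record morphism (lam : C) phi m m' : Prop := Morphism {
  mor_A : forall U, phi (Um U) *m mA m U = mA m' U *m phi (Up U);
  mor_b : forall U, mb m' U *m phi (Up U) = lam *: mb m U;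
  mor_a : forall U, phi (Um U) *m ma m U = lam *: ma m' U;
  mor_B : forall U, phi (Um U) *m mB m U = mB m' U *m phi (Um U);
  mor_B' : forall U, phi (Up U) *m mB' m U = mB' m' U *m phi (Up U);
  mor_C : forall V, phi (Vm V) *m mC m V = mC m' V *m phi (Vp V);
  mor_D : forall V, phi (Vp V) *m mD m V = mD m' V *m phi (Vm V)
}.

Lemma rep_ext m m' :
  (forall U, mA m U = mA m' U) -> (forall U, mb m U = mb m' U) ->
  (forall U, ma m U = ma m' U) -> (forall U, mB m U = mB m' U) ->
  (forall U, mB' m U = mB' m' U) -> (forall V, mC m V = mC m' V) ->
  (forall V, mD m V = mD m' V) -> m = m'.
Proof.
case: m m' => A b a B B' c d [A1 b1 a1 B1 B1' c1 d1] /=.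
by move=> *; congr Rep; apply: functional_extensionality_dep.
Qed.

Lemma gauge_act_morphism g m : gauge_group g -> morphism 1 g m (gauge_act g m).
Proof.
by move=> ug; split=> W /=; rewrite ?scale1r ?mulmxKV.
Qed.

Lemma morphism_gauge_act g m m' : gauge_group g -> morphism 1 g m m' ->
  gauge_act g m = m'.
Proof.
move=> ug [hA hb ha hB hB' hC hD]; apply: rep_ext => W /=.
- by rewrite hA mulmxK.
- by rewrite -[mb m W]scale1r -hb mulmxK.
- by rewrite ha scale1r.
- by rewrite hB mulmxK.
- by rewrite hB' mulmxK.
- by rewrite hC mulmxK.
- by rewrite hD mulmxK.
Qed.

Lemma morphism_comp g h m m' m'' : morphism 1 g m' m'' -> morphism 1 h m m' ->
  morphism 1 (fun X => g X *m h X) m m''.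
Proof.
move=> [hA hb ha hB hB' hC hD] [kA kb ka kB kB' kC kD].
split=> W.
- by rewrite -mulmxA kA !mulmxA hA.
- by rewrite mulmxA hb scale1r kb.
- by rewrite -mulmxA ka scale1r ha.
- by rewrite -mulmxA kB !mulmxA hB.
- by rewrite -mulmxA kB' !mulmxA hB'.
- by rewrite -mulmxA kC !mulmxA hC.
- by rewrite -mulmxA kD !mulmxA hD.
Qed.

Lemma gauge_group_mul g h : gauge_group g -> gauge_group h ->
  gauge_group (fun X => g X *m h X).
Proof. by move=> ug uh X; rewrite unitmx_mul ug uh. Qed.

Lemma gauge_group_inv g : gauge_group g -> gauge_group (fun X => invmx (g X)).
Proof. by move=> ug X; rewrite unitmx_inv. Qed.

Lemma gauge_group1 : gauge_group (fun X : D3 D => 1%:M : 'M[C]_(mult X)).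
Proof. by move=> X; rewrite unitmx1. Qed.

Lemma gauge_actM g h m : gauge_group g -> gauge_group h ->
  gauge_act g (gauge_act h m) = gauge_act (fun X => g X *m h X) m.
Proof.
move=> ug uh; symmetry; apply: morphism_gauge_act; first exact: gauge_group_mul.
by apply: morphism_comp; apply: gauge_act_morphism.
Qed.

Lemma morphism_id m : morphism 1 (fun X => 1%:M) m m.
Proof. by split=> W; rewrite ?mul1mx ?mulmx1 ?scale1r. Qed.

Lemma gauge_act1 m : gauge_act (fun X => 1%:M) m = m.
Proof.
by apply: morphism_gauge_act; [exact: gauge_group1 | exact: morphism_id].
Qed.

Lemma gauge_actV g m : gauge_group g ->
  gauge_act (fun X => invmx (g X)) (gauge_act g m) = m.
Proof.
move=> ug; rewrite gauge_actM //; last exact: gauge_group_inv.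
rewrite -[RHS]gauge_act1; congr gauge_act.
by apply: functional_extensionality_dep => X; rewrite mulVmx.
Qed.

Lemma morphismB lam g h m m' : morphism lam g m m' -> morphism lam h m m' ->
  morphism 0 (fun X => g X - h X) m m'.
Proof.
move=> [hA hb ha hB hB' hC hD] [kA kb ka kB kB' kC kD].
by split=> W; rewrite ?scale0r ?[(_ - _) *m _]mulmxBl ?[_ *m (_ - _)]mulmxBr
  ?hA ?hb ?ha ?hB ?hB' ?hC ?hD ?kA ?kb ?ka ?kB ?kB' ?kC ?kD ?subrr.
Qed.

Lemma S1_gauge_act g m U : gauge_group g -> S1 m U -> S1 (gauge_act g m) U.
Proof.
move=> ug s1 S SB SA Sb.
pose f := linfun (mulmx (g (Up U)) : 'cV[C]_(mult (Up U)) -> 'cV[C]_(mult (Up U))).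
have inf v : (v \in f @^-1: S)%VS = (g (Up U) *m v \in S).
  by rewrite -memv_preim lfunE.
have S0 : (f @^-1: S)%VS = 0%VS.
  apply: s1 => v; rewrite !inf => vS.
  - by have := SB _ vS; rewrite /= !mulmxA mulmxKV // -mulmxA.
  - have := SA _ vS; rewrite /= !mulmxA mulmxKV // -mulmxA => e.
    by rewrite -[_ *m v](mulKmx (ug (Um U))) e mulmx0.
  - by have := Sb _ vS; rewrite /= !mulmxA mulmxKV.
apply/eqP; rewrite -subv0; apply/subvP => v vS.
have : (invmx (g (Up U)) *m v \in f @^-1: S)%VS by rewrite inf mulKVmx.
by rewrite S0 !memv0 => /eqP e; rewrite -[v](mulKVmx (ug (Up U))) e mulmx0.
Qed.

Lemma S2_gauge_act g m U : gauge_group g -> S2 m U -> S2 (gauge_act g m) U.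
Proof.
move=> ug s2 T TB TAa.
pose f := linfun (mulmx (g (Um U)) : 'cV[C]_(mult (Um U)) -> 'cV[C]_(mult (Um U))).
have inf v : (v \in f @^-1: T)%VS = (g (Um U) *m v \in T).
  by rewrite -memv_preim lfunE.
have Tf : (f @^-1: T)%VS = fullv.
  apply: s2 => [v | v z]; rewrite !inf.
  - by move=> /TB; rewrite /= !mulmxA mulmxKV // -mulmxA.
  - have := TAa (g (Up U) *m v) z.
    by rewrite /= !mulmxA mulmxKV // mulmxDr !mulmxA.
apply/eqP; rewrite eqEsubv subvf; apply/subvP => v _.
have : (invmx (g (Um U)) *m v \in f @^-1: T)%VS by rewrite Tf memvf.
by rewrite inf mulKVmx.
Qed.

(** Two 5-branes at consecutive positions share a D3 brane, but the two
    descriptions of that D3 brane carry different proofs of its bound. *)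
Lemma gauge_irr g n (h1 h2 : (n < (size (branes D)).+1)%N) :
  g (Ordinal h1) = g (Ordinal h2) :> 'M_(nth 0%N (mults D) n).
Proof. by rewrite (bool_irrelevance h1 h2). Qed.

Lemma moment_zero_gauge_act g m : gauge_group g ->
  moment_zero m -> moment_zero (gauge_act g m).
Proof.
move=> ug [mu1 mu2 mu3 mu4 mu5]; split=> [U | k h h' | k h h' | k h h' | k h h'].
- transitivity (g (Um U) *m (mB m U *m mA m U - mA m U *m mB' m U
                              + ma m U *m mb m U) *m invmx (g (Up U))).
    rewrite !(mulmxDr, mulmxDl, mulmxN, mulNmx) /= !mulmxA.
    by rewrite !mulmxKV.
  by rewrite mu1 mulmx0 mul0mx.
- have e : g (Up (mkD5 h)) = g (Um (mkD5 h')) :> 'M_(nth 0%N (mults D) k.+1).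
    exact: gauge_irr.
  have /= /eqP := mu2 k h h'; rewrite subr_eq0 => /eqP mu.
  by rewrite /= mu e subrr.
- have e : g (Vp (mkNS5 h)) = g (Vm (mkNS5 h')) :> 'M_(nth 0%N (mults D) k.+1).
    exact: gauge_irr.
  have /= /eqP := mu3 k h h'; rewrite subr_eq0 => /eqP mu.
  have u := ug (Vp (mkNS5 h)).
  rewrite /= !mulmxA !mulmxKV // -e -[_ *m _ *m mD m _]mulmxA mu.
  by rewrite !mulmxA subrr.
- have e : g (Vp (mkNS5 h)) = g (Um (mkD5 h')) :> 'M_(nth 0%N (mults D) k.+1).
    exact: gauge_irr.
  have /= /eqP := mu4 k h h'; rewrite subr_eq0 => /eqP mu.
  rewrite /= !mulmxA !mulmxKV // -mu -e.
  by rewrite mulmxN mulNmx opprK !mulmxA addNr.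
- have e : g (Up (mkD5 h)) = g (Vm (mkNS5 h')) :> 'M_(nth 0%N (mults D) k.+1).
    exact: gauge_irr.
  have /= /eqP := mu5 k h h'; rewrite addr_eq0 => /eqP mu.
  rewrite /= !mulmxA !mulmxKV // -e -[_ *m _ *m mD m _]mulmxA mu.
  by rewrite mulmxN mulNmx addNr.
Qed.

Lemma Mtilde_gauge_act g m : gauge_group g -> Mtilde m -> Mtilde (gauge_act g m).
Proof.
move=> ug [mu s12]; split; first exact: moment_zero_gauge_act.
by move=> U; have [s1 s2] := s12 U; split;
  [exact: S1_gauge_act | exact: S2_gauge_act].
Qed.

(** Condition (S1) applied to the column space of [W], which is invariant
    because [mB'] acts on the columns of [W] through [L]. *)
Lemma S1_mx m U k (W : 'M[C]_(mult (Up U), k)) (L : 'M_k) : S1 m U ->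
  mB' m U *m W = W *m L -> mA m U *m W = 0 -> mb m U *m W = 0 -> W = 0.
Proof.
move=> s1 BW AW bW.
pose f := linfun (mulmx W : 'cV[C]_k -> 'cV[C]_(mult (Up U))).
have f0 : limg f = 0%VS.
  apply: s1 => _ /memv_imgP [v _ ->]; rewrite lfunE /= !mulmxA.
  - rewrite BW -mulmxA; have := memv_img f (memvf (L *m v)).
    by rewrite lfunE.
  - by rewrite AW mul0mx.
  - by rewrite bW mul0mx.
apply/matrixP => i j; rewrite mxE.
have : f (delta_mx j 0) \in limg f by rewrite memv_img ?memvf.
by rewrite f0 memv0 lfunE /= -colE => /eqP/matrixP/(_ i 0); rewrite !mxE.
Qed.

End Gauge.

(** * Regular functions at a point and Cramer's rule *)

Section Regular.
Variables (R : realType) (D : brane_diagram).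
Local Notation C := R[i].
Implicit Types (f : rep R D * C -> C) (p : rep R D * C).

Lemma polyfun_opp f : polyfun f -> polyfun (fun p => - f p).
Proof.
move=> pf; have := pf_mul (pf_const D (-1)) pf.
by under eq_fun do rewrite mulN1r.
Qed.

Lemma polyfun_sum (I : Type) (r : seq I) (F : I -> rep R D * C -> C) :
  (forall i, polyfun (F i)) -> polyfun (fun p => \sum_(i <- r) F i p).
Proof.
move=> pF; elim: r => [|i r IH].
  by under eq_fun do rewrite big_nil; exact: pf_const.
by under eq_fun do rewrite big_cons; exact: pf_add.
Qed.

Section At.
Variable p0 : rep R D * C.

(** The local ring at [p0] of the affine space: quotients of polynomial
    functions whose denominator does not vanish at [p0]. The equation is only
    asked where the denominator does not vanish, so that [f] may be arbitrary
    elsewhere. *)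
Definition regular f : Prop := exists d g,
  [/\ polyfun d, polyfun g, d p0 != 0 & forall p, d p != 0 -> d p * f p = g p].

Lemma regular_poly f : polyfun f -> regular f.
Proof.
move=> pf; exists (fun=> 1), f.
by split=> //; [exact: pf_const | exact: oner_neq0 | move=> p _; rewrite mul1r].
Qed.

Lemma regular_const c : regular (fun=> c).
Proof. by apply: regular_poly; exact: pf_const. Qed.

Lemma regular_add f g : regular f -> regular g -> regular (fun p => f p + g p).
Proof.
move=> [d [a [pd pa d0 da]]] [e [b [pe pb e0 eb]]].
exists (fun p => d p * e p), (fun p => e p * a p + d p * b p); split.
- exact: pf_mul.
- by apply: pf_add; apply: pf_mul.
- by rewrite mulf_neq0.
- by move=> p; rewrite mulf_eq0 negb_or => /andP [/da <- /eb <-]; ring.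
Qed.

Lemma regular_mul f g : regular f -> regular g -> regular (fun p => f p * g p).
Proof.
move=> [d [a [pd pa d0 da]]] [e [b [pe pb e0 eb]]].
exists (fun p => d p * e p), (fun p => a p * b p); split.
- exact: pf_mul.
- exact: pf_mul.
- by rewrite mulf_neq0.
- by move=> p; rewrite mulf_eq0 negb_or => /andP [/da <- /eb <-]; ring.
Qed.

Lemma regular_inv f : regular f -> f p0 != 0 -> regular (fun p => (f p)^-1).
Proof.
move=> [d [a [pd pa d0 da]]] f0.
exists (fun p => d p * a p), (fun p => d p * d p); split.
- exact: pf_mul.
- exact: pf_mul.
- by rewrite -da // !mulf_neq0.
- move=> p; rewrite mulf_eq0 negb_or => /andP [dp ap].
  have := ap; rewrite -(da _ dp) mulf_eq0 negb_or => /andP [_ fp].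
  by field.
Qed.

Lemma regular_sum (I : Type) (r : seq I) (F : I -> rep R D * C -> C) :
  (forall i, regular (F i)) -> regular (fun p => \sum_(i <- r) F i p).
Proof.
move=> pF; elim: r => [|i r IH].
  by under eq_fun do rewrite big_nil; exact: regular_const.
by under eq_fun do rewrite big_cons; exact: regular_add.
Qed.

Lemma regular_prod (I : Type) (r : seq I) (F : I -> rep R D * C -> C) :
  (forall i, regular (F i)) -> regular (fun p => \prod_(i <- r) F i p).
Proof.
move=> pF; elim: r => [|i r IH].
  by under eq_fun do rewrite big_nil; exact: regular_const.
by under eq_fun do rewrite big_cons; exact: regular_mul.
Qed.

Definition regular_mx a b (M : rep R D * C -> 'M[C]_(a, b)) : Prop :=
  forall i j, regular (fun p => M p i j).

Lemma regular_mxM a b c (M : rep R D * C -> 'M[C]_(a, b))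
  (N : rep R D * C -> 'M[C]_(b, c)) :
  regular_mx M -> regular_mx N -> regular_mx (fun p => M p *m N p).
Proof.
move=> rM rN i j; under eq_fun do rewrite mxE.
by apply: regular_sum => k; exact: regular_mul.
Qed.

Lemma regular_det n (M : rep R D * C -> 'M[C]_n) :
  regular_mx M -> regular (fun p => \det (M p)).
Proof.
move=> rM; rewrite /determinant; apply: regular_sum => s.
apply: regular_mul; first exact: regular_const.
exact: regular_prod.
Qed.

Lemma regular_adj n (M : rep R D * C -> 'M[C]_n) :
  regular_mx M -> regular_mx (fun p => \adj (M p)).
Proof.
move=> rM i j; under eq_fun do rewrite mxE.
apply: regular_mul; first exact: regular_const.
by apply: regular_det => k l; under eq_fun do rewrite !mxE; exact: rM.
Qed.

(** Vanishing on [O] passes to the Zariski closure of [O]: the product of the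
    numerator and the denominator is a polynomial that vanishes on [O]. *)
Lemma regular_zero (O : set (rep R D * C)) f : regular f ->
  (forall g, polyfun g -> (forall p, O p -> g p = 0) -> g p0 = 0) ->
  (forall p, O p -> f p = 0) -> f p0 = 0.
Proof.
move=> [d [a [pd pa d0 da]]] p0O fO.
have : d p0 * a p0 = 0.
  apply: (p0O (fun p => d p * a p)); first exact: pf_mul.
  move=> p /fO fp; have [->|dp] := eqVneq (d p) 0; first by rewrite mul0r.
  by rewrite -da // fp !mulr0.
by move/eqP; rewrite -da // !mulf_eq0 (negPf d0) /= => /eqP.
Qed.

End At.

(** Cramer's rule: a linear system whose coefficients depend polynomially on a
    point, and which has a solution [x p] at every point [p] of [O], still has
    a solution [x0] at a point [p0] of the Zariski closure of [O], as long as
    its solution there is unique. Composing the system with a left inverse, at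
    [p0], of its matrix gives a square system whose determinant is [1] at [p0],
    hence a solution that is a regular function near [p0]. For the same reason
    every algebraic relation [q] between [p] and [x p] persists at [p0]. *)
Lemma cramer_closed n k (E : rep R D * C -> 'M[C]_(n, k))
    (c : rep R D * C -> 'rV[C]_k) (O : set (rep R D * C)) p0
    (x : rep R D * C -> 'rV[C]_n) :
  (forall i j, polyfun (fun p => E p i j)) ->
  (forall j, polyfun (fun p => c p 0 j)) ->
  (forall p, O p -> x p *m E p = c p) ->
  row_free (E p0) ->
  (forall g, polyfun g -> (forall p, O p -> g p = 0) -> g p0 = 0) ->
  exists x0 : 'rV_n, x0 *m E p0 = c p0 /\
    forall q : rep R D * C -> 'rV_n -> C,
      (forall y, regular_mx p0 y -> regular p0 (fun p => q p (y p))) ->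
      (forall p, O p -> q p (x p) = 0) -> q p0 x0 = 0.
Proof.
move=> pE pc xO free0 p0O.
have rE : regular_mx p0 E by move=> i j; apply: regular_poly.
have rc : regular_mx p0 c.
  by move=> i j; rewrite (ord1 i); apply: regular_poly.
pose P := pinvmx (E p0).
have rP : regular_mx p0 (fun=> P) by move=> i j; exact: regular_const.
pose M p := E p *m P.
have rM : regular_mx p0 M by apply: regular_mxM.
have M0 : M p0 = 1%:M by rewrite /M mulmxVp.
(* the adjugate keeps [y] regular, whereas [invmx] is defined by cases *)
pose y p : 'rV_n := c p *m P *m ((\det (M p))^-1 *: \adj (M p)).
have ry : regular_mx p0 y.
  apply: regular_mxM; first exact: regular_mxM.
  move=> i j; under eq_fun do rewrite mxE.
  apply: regular_mul; last exact: regular_adj.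
  apply: regular_inv; first exact: regular_det.
  by rewrite M0 det1 oner_neq0.
have yO p : O p -> \det (M p) != 0 -> y p = x p.
  move=> Op dp; rewrite /y -(xO _ Op) -scalemxAr -[_ *m E p *m P]mulmxA -/(M p).
  by rewrite -mulmxA mul_mx_adj mul_mx_scalar scalerA mulVf ?scale1r.
have zeroO q : (forall y, regular_mx p0 y -> regular p0 (fun p => q p (y p))) ->
    (forall p, O p -> q p (x p) = 0) -> q p0 (y p0) = 0.
  move=> rq qO.
  (* multiplying by the determinant discards the points where y <> x *)
  have : \det (M p0) * q p0 (y p0) = 0.
    apply: (@regular_zero p0 O (fun p => \det (M p) * q p (y p))) => //.
      by apply: regular_mul; [exact: regular_det | exact: rq].
    move=> p Op; have [->|dp] := eqVneq (\det (M p)) 0; first by rewrite mul0r.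
    by rewrite yO // qO // mulr0.
  by rewrite M0 det1 mul1r.
exists (y p0); split=> //.
apply/rowP => j; apply/eqP; rewrite -subr_eq0; apply/eqP.
apply: (zeroO (fun p v => (v *m E p) 0 j - c p 0 j)) => [v rv | p Op].
  apply: regular_add; first exact: regular_mxM.
  by apply: regular_poly; apply: polyfun_opp.
by rewrite xO ?subrr.
Qed.

End Regular.

(** * Closed orbits and trivial stabilizers from uniqueness of morphisms *)

Section OrbitClosed.
Variables (R : realType) (D : brane_diagram).
Local Notation C := R[i].
Implicit Types (m : rep R D) (g phi : forall X : D3 D, 'M[C]_(mult X)).

(** The morphisms between two fixed representations are the solutions of a
    linear system; its unknowns are the entries of the matrices at all D3
    branes, and its equations the entries of the commutation relations. *)
Definition gauge_index : finType :=
  {X : D3 D & ('I_(mult X) * 'I_(mult X))%type}.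

Definition gauge_of (x : 'rV[C]_#|gauge_index|) (X : D3 D) : 'M[C]_(mult X) :=
  \matrix_(i, j) x 0 (enum_rank
    (Tagged (fun X : D3 D => ('I_(mult X) * 'I_(mult X))%type) (i, j))).

Definition vec_of g : 'rV[C]_#|gauge_index| :=
  \row_k g (tag (enum_val k)) (tagged (enum_val k)).1 (tagged (enum_val k)).2.

Lemma vec_ofK g X : gauge_of (vec_of g) X = g X.
Proof. by apply/matrixP => i j; rewrite !mxE enum_rankK. Qed.

Lemma gauge_ofK x : vec_of (gauge_of x) = x.
Proof.
apply/rowP => k; rewrite !mxE; congr (x 0 _).
by apply: enum_val_inj; rewrite enum_rankK; case: (enum_val k) => X [i j].
Qed.

Lemma gauge_of_linear c x y X :
  gauge_of (c *: x + y) X = c *: gauge_of x X + gauge_of y X.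
Proof. by apply/matrixP => i j; rewrite !mxE. Qed.

Definition equation_index : finType := (
    {U : D5 D & ('I_(mult (Um U)) * 'I_(mult (Up U)))%type}
  + {U : D5 D & 'I_(mult (Up U))}
  + {U : D5 D & 'I_(mult (Um U))}
  + {U : D5 D & ('I_(mult (Um U)) * 'I_(mult (Um U)))%type}
  + {U : D5 D & ('I_(mult (Up U)) * 'I_(mult (Up U)))%type}
  + {V : NS5 D & ('I_(mult (Vm V)) * 'I_(mult (Vp V)))%type}
  + {V : NS5 D & ('I_(mult (Vp V)) * 'I_(mult (Vm V)))%type})%type.

Definition morphism_lhs phi m m' (e : equation_index) : C :=
  match e with
  | inl (inl (inl (inl (inl (inl (existT U (i, j))))))) =>
      (phi (Um U) *m mA m U - mA m' U *m phi (Up U)) i j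
  | inl (inl (inl (inl (inl (inr (existT U j)))))) =>
      (mb m' U *m phi (Up U)) 0 j
  | inl (inl (inl (inl (inr (existT U i))))) =>
      (phi (Um U) *m ma m U) i 0
  | inl (inl (inl (inr (existT U (i, j))))) =>
      (phi (Um U) *m mB m U - mB m' U *m phi (Um U)) i j
  | inl (inl (inr (existT U (i, j)))) =>
      (phi (Up U) *m mB' m U - mB' m' U *m phi (Up U)) i j
  | inl (inr (existT V (i, j))) =>
      (phi (Vm V) *m mC m V - mC m' V *m phi (Vp V)) i j
  | inr (existT V (i, j)) =>
      (phi (Vp V) *m mD m V - mD m' V *m phi (Vm V)) i j
  end.

Definition morphism_rhs m m' (e : equation_index) : C :=
  match e with
  | inl (inl (inl (inl (inl (inr (existT U j)))))) => mb m U 0 j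
  | inl (inl (inl (inl (inr (existT U i))))) => ma m' U i 0
  | _ => 0
  end.

Lemma morphism_equations lam phi m m' : morphism lam phi m m' <->
  forall e, morphism_lhs phi m m' e = lam * morphism_rhs m m' e.
Proof.
split=> [[hA hb ha hB hB' hC hD] | he].
  case=> [[[[[[[U [i j]]|[U j]]|[U i]]|[U [i j]]]|[U [i j]]]|[V [i j]]]|[V [i j]]] /=;
  by rewrite ?mulr0 ?hA ?hb ?ha ?hB ?hB' ?hC ?hD ?subrr mxE.
split=> W.
- apply/eqP; rewrite -subr_eq0; apply/eqP/matrixP => i j; rewrite [RHS]mxE.
  by have /= := he (inl (inl (inl (inl (inl (inl (existT _ W (i, j)))))))); rewrite mulr0.
- apply/rowP => j; rewrite [RHS]mxE.
  exact: (he (inl (inl (inl (inl (inl (inr (existT _ W j)))))))).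
- apply/colP => i; rewrite [RHS]mxE.
  exact: (he (inl (inl (inl (inl (inr (existT _ W i))))))).
- apply/eqP; rewrite -subr_eq0; apply/eqP/matrixP => i j; rewrite [RHS]mxE.
  by have /= := he (inl (inl (inl (inr (existT _ W (i, j)))))); rewrite mulr0.
- apply/eqP; rewrite -subr_eq0; apply/eqP/matrixP => i j; rewrite [RHS]mxE.
  by have /= := he (inl (inl (inr (existT _ W (i, j))))); rewrite mulr0.
- apply/eqP; rewrite -subr_eq0; apply/eqP/matrixP => i j; rewrite [RHS]mxE.
  by have /= := he (inl (inr (existT _ W (i, j)))); rewrite mulr0.
- apply/eqP; rewrite -subr_eq0; apply/eqP/matrixP => i j; rewrite [RHS]mxE.
  by have /= := he (inr (existT _ W (i, j))); rewrite mulr0.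
Qed.

Lemma morphism_lhs_linear m m' e c x y :
  morphism_lhs (gauge_of (c *: x + y)) m m' e =
  c * morphism_lhs (gauge_of x) m m' e + morphism_lhs (gauge_of y) m m' e.
Proof.
have mxD a b (P Q : 'M[C]_(a, b)) i j : (c *: P + Q) i j = c * P i j + Q i j.
  by rewrite !mxE.
have mxB a b (P Q P' Q' : 'M[C]_(a, b)) i j :
    (c *: P + Q - (c *: P' + Q')) i j = c * (P - P') i j + (Q - Q') i j.
  by rewrite !mxE; ring.
case: e => [[[[[[[U [i j]]|[U j]]|[U i]]|[U [i j]]]|[U [i j]]]|[V [i j]]]|[V [i j]]] /=;
rewrite !gauge_of_linear ?mulmxDl ?mulmxDr -?scalemxAl -?scalemxAr;
  first [exact: mxB | exact: mxD].
Qed.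

Lemma morphism_lhs_poly phi m e :
  polyfun (fun p : rep R D * C => morphism_lhs phi m p.1 e).
Proof.
have pf_Mmx a b c (M : rep R D * C -> 'M[C]_(a, b)) (N : 'M_(b, c)) i j :
    (forall k, polyfun (fun p => M p i k)) -> polyfun (fun p => (M p *m N) i j).
  move=> pM; under eq_fun do rewrite mxE; apply: polyfun_sum => k.
  by apply: pf_mul => //; exact: pf_const.
case: e => [[[[[[[U [i j]]|[U j]]|[U i]]|[U [i j]]]|[U [i j]]]|[V [i j]]]|[V [i j]]] /=;
  [|apply: pf_Mmx => k; exact: pf_b|exact: pf_const| | | |];
  under eq_fun do rewrite mxE [X in _ + X]mxE;
  (apply: pf_add; first exact: pf_const); apply: polyfun_opp;
  apply: pf_Mmx => k; constructor.
Qed.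

Lemma morphism_rhs_poly m e :
  polyfun (fun p : rep R D * C => morphism_rhs m p.1 e).
Proof.
by case: e => [[[[[[[U [i j]]|[U j]]|[U i]]|[U [i j]]]|[U [i j]]]|[V [i j]]]|[V [i j]]] /=;
  constructor.
Qed.

(** Invertibility at the D3 branes to the right of NS5 branes, which is what
    the character [chi] detects, spreads to all of them from left to right: at
    a D5 brane [U], the kernel of [phi] at [U^+] is invariant and killed by
    [mA] and [mb] once [phi] is injective at [U^-], so (S1) makes it zero. *)
Lemma morphism_unit phi m m' : (forall U, S1 m U) -> morphism 1 phi m m' ->
  (forall V, phi (Vp V) \in unitmx) -> gauge_group phi.
Proof.
move=> s1 [hA hb ha hB hB' hC hD] uV [k hk].
elim: k hk => [|k IH] hk.
  apply: unitmx_left_inj => v _; apply/colP => i; exfalso.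
  have : (i < nth 0 (mults D) 0)%N by exact: ltn_ord.
  by rewrite mults_first.
have hkN : (k < size (branes D))%N by [].
have [kD5|kNS5] := brane_cases hkN.
- pose U := mkD5 kD5.
  have -> : Ordinal hk = Up U by apply: val_inj.
  have uU : phi (Um U) \in unitmx.
    have -> : Um U = Ordinal (ltnW hk) by apply: val_inj.
    exact: IH.
  apply: unitmx_left_inj => v v0.
  suff f0 : lker (linfun (mulmx (phi (Up U)) :
      'cV[C]_(mult (Up U)) -> 'cV[C]_(mult (Up U)))) = 0%VS.
    by apply/eqP; rewrite -memv0 -f0 memv_ker lfunE /= v0.
  apply: (s1 U) => {v0}v; rewrite !memv_ker !lfunE /= => /eqP v0.
  + by rewrite mulmxA hB' -mulmxA v0 mulmx0.
  + by apply: (can_inj (mulKmx uU)); rewrite mulmxA hA -mulmxA v0 !mulmx0.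
  + by rewrite -[mb m U]scale1r -hb -mulmxA v0 mulmx0.
- have -> : Ordinal hk = Vp (mkNS5 kNS5) by apply: val_inj.
  exact: uV.
Qed.

Lemma chi_regular p0 (y : rep R D * C -> 'rV[C]_#|gauge_index|) :
  regular_mx p0 y -> regular p0 (fun p => chi (gauge_of (y p))).
Proof.
move=> ry; apply: regular_prod => V; apply: regular_det => i j.
by under eq_fun do rewrite mxE; exact: ry.
Qed.

(** Rigidity of [m] says that the linear system for morphisms out of [m] has at
    most one solution, whatever the target satisfying (S1). It plays the role
    of the generation of all spaces from the framing. *)
Definition rigid m : Prop := forall m' phi, (forall U, S1 m' U) ->
  morphism 0 phi m m' -> forall X, phi X = 0.

(** At a point [p0] of the closure of the orbit, the gauge transformations
    carrying [m] to the points of the orbit specialize, by Cramer's rule, to a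
    morphism from [m] to [p0]; the relation [chi g * p.2 = z] specializes too
    and shows that [chi] of this morphism is not zero, so that the morphism is
    itself a gauge transformation. *)
Lemma orbit_closed m (z : C) : Mtilde m -> rigid m -> z != 0 ->
  zariski_closed_in (@Mtilde R D `*` setT)
    [set gauge_act_z g (m, z) | g in @gauge_group R D].
Proof.
move=> Mm rigm z0.
set O := [set gauge_act_z g (m, z) | g in _].
exists [set f | polyfun f /\ forall p, O p -> f p = 0]; first by move=> f [].
apply/seteqP; split=> [p Op | p0 [[Mp0 _] p0O]].
  split; last by move=> f [_]; apply.
  by case: Op => g ug <-; split=> //=; exact: Mtilde_gauge_act.
pose I := equation_index.
pose E (p : rep R D * C) : 'M[C]_(#|gauge_index|, #|I|) :=
  \matrix_(i, e) morphism_lhs (gauge_of (delta_mx 0 i)) m p.1 (enum_val e).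
pose c (p : rep R D * C) : 'rV[C]_#|I| := \row_e morphism_rhs m p.1 (enum_val e).
have EP x p e : (x *m E p) 0 e = morphism_lhs (gauge_of x) m p.1 (enum_val e).
  rewrite (linear_fun_delta (f := fun x => morphism_lhs (gauge_of x) m p.1 _)).
    by rewrite mxE; apply: eq_bigr => i _; rewrite !mxE.
  by move=> *; exact: morphism_lhs_linear.
have solP x p : x *m E p = c p <-> morphism 1 (gauge_of x) m p.1.
  rewrite morphism_equations; split=> [xE e | he].
    by rewrite mul1r -[e]enum_rankK -EP xE mxE.
  by apply/rowP => e; rewrite EP he mul1r mxE.
have orbP p : O p -> exists g, [/\ gauge_group g, gauge_act g m = p.1
    & (chi g)^-1 * z = p.2] by case=> g ug <-; exists g.
pose x p : 'rV[C]_#|gauge_index| :=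
  if pselect (O p) is left Op then vec_of (sval (cid (orbP p Op))) else 0.
have xP p : O p -> [/\ gauge_group (gauge_of (x p)),
    gauge_act (gauge_of (x p)) m = p.1 & (chi (gauge_of (x p)))^-1 * z = p.2].
  rewrite /x => Op; case: pselect => // Op'; case: cid => g /= gP.
  have -> // : gauge_of (vec_of g) = g.
  by apply: functional_extensionality_dep => X; exact: vec_ofK.
have [|||||x0 [x0E x0q]] := @cramer_closed R D _ _ E c O p0 x.
- by move=> i e; under eq_fun do rewrite mxE; exact: morphism_lhs_poly.
- by move=> e; under eq_fun do rewrite mxE; exact: morphism_rhs_poly.
- move=> p /xP [ug gm _]; apply/solP; rewrite -gm.
  exact: gauge_act_morphism.
- rewrite -kermx_eq0; apply/eqP/row_matrixP => i; rewrite row0.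
  set v := row i _.
  have v0 : v *m E p0 = 0 by rewrite -row_mul mulmx_ker row0.
  have hv : morphism 0 (gauge_of v) m p0.1.
    apply/morphism_equations => e.
    by rewrite -[e]enum_rankK -EP v0 mxE mul0r.
  have S1p0 U : S1 p0.1 U by have [_ /(_ U) []] := Mp0.
  rewrite -[LHS]gauge_ofK; apply/rowP => j; rewrite [LHS]mxE.
  by rewrite (rigm _ _ S1p0 hv) !mxE.
- by move=> f pf fO; apply: p0O; split.
pose q (p : rep R D * C) y := chi (gauge_of y) * p.2 - z.
have chi_z : chi (gauge_of x0) * p0.2 = z.
  apply/eqP; rewrite -subr_eq0; apply/eqP.
  apply: (x0q q) => [y ry | p /xP [ug _ pz]]; rewrite /q.
    apply: regular_add; last exact: regular_const.
    by apply: regular_mul; [exact: chi_regular | apply: regular_poly; exact: pf_z].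
  rewrite -pz mulrA mulfV ?mul1r ?subrr //.
  by apply/prodf_neq0 => V _; rewrite -unitfE; exact: ug.
have chi0 : chi (gauge_of x0) != 0.
  by apply: contra_neq z0 => chi0; rewrite -chi_z chi0 mul0r.
have hx0 : morphism 1 (gauge_of x0) m p0.1 by apply/solP.
have ux0 : gauge_group (gauge_of x0).
  apply: morphism_unit hx0 _ => [U | V]; first by have [_ /(_ U) []] := Mm.
  by rewrite unitmxE unitfE; move/prodf_neq0: chi0; apply.
exists (gauge_of x0) => //.
rewrite /gauge_act_z /= (morphism_gauge_act ux0 hx0) -chi_z mulKf //.
by case: (p0).
Qed.

(** An element of the stabilizer and the identity solve the same linear
    system. *)
Lemma rigid_free m g : (forall U, S1 m U) -> rigid m -> gauge_group g ->
  gauge_act g m = m -> g = fun=> 1%:M.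
Proof.
move=> s1 rigm ug gm; apply: functional_extensionality_dep => X.
apply/eqP; rewrite -subr_eq0; apply/eqP.
apply: (rigm m (fun X => g X - 1%:M) s1).
apply: morphismB (morphism_id m).
by rewrite -{2}gm; exact: gauge_act_morphism.
Qed.

End OrbitClosed.

(** * Columns of a butterfly across a 5-brane *)

Section Dots.
Variables (D : brane_diagram) (S : tie_diagram D).
Implicit Types (U : D5 D) (V : NS5 D) (X : D3 D) (p : D5 D * int).

Lemma posU_inj U U' : posU U = posU U' -> U = U'.
Proof. by move=> e; apply: val_inj; apply: val_inj. Qed.

Lemma posV_inj V V' : posV V = posV V' -> V = V'.
Proof. by move=> e; apply: val_inj; apply: val_inj. Qed.

Lemma posU_neq_posV U V : posU U != posV V.
Proof.
apply/eqP => e; have := valP U; have := valP V.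
rewrite /D5at /NS5at -[nat_of_ord (val U)]/(posU U) e => /andP [hk +] /andP [_].
by rewrite -[nat_of_ord (val V)]/(posV V) (set_nth_default NS5brane) // => /negP.
Qed.

(** The height just below the column, so that the heights of its dots are those
    [s] with [column_bottom U X < s <= top S U X]. *)
Definition column_bottom U X : int := top S U X - (ncover S U X)%:Z.

Lemma mem_dots U s X :
  ((U, s) \in dots S X) = (column_bottom U X < s <= top S U X).
Proof.
rewrite /column_bottom; apply/idP/idP.
  move=> /allpairsPdep [U' [s' [_ /mapP [k]]]].
  by rewrite mem_iota => /andP [_ hk] -> [-> ->]; lia.
move=> hs; apply/allpairsPdep; exists U, s; split=> //; first by rewrite mem_enum.
apply/mapP; exists `|top S U X - s|%N; last by lia.
by rewrite mem_iota; lia.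
Qed.

Lemma dots_uniq X : uniq (dots S X).
Proof.
apply: allpairs_uniq_dep; first exact: enum_uniq.
  move=> U _; rewrite map_inj_uniq ?iota_uniq // => k l; lia.
by move=> [U s] [U' s'] _ _ /= [-> ->].
Qed.

Lemma dot_mem X (i : 'I_(mult X)) : dot S i \in dots S X.
Proof. exact: mem_tnth. Qed.

Lemma dot_inj X : injective (@dot D S X).
Proof. by move=> i j; apply/tuple_uniqP; exact: dots_uniq. Qed.

Lemma dot_onto X p : p \in dots S X -> exists i : 'I_(mult X), dot S i = p.
Proof. by move=> /(@tnthP _ _ (Tuple (size_dots S X))) [i ->]; exists i. Qed.

Lemma ncover_D5 U U' : U != U' -> ncover S U (Um U') = ncover S U (Up U').
Proof.
move=> UU'; apply: eq_card => -[U1 V1]; rewrite !inE /=; congr (_ && _).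
case: eqVneq => //= ->.
have : posU U != posU U' by apply: contra_neq UU'; exact: posU_inj.
have := posU_neq_posV U' V1.
rewrite /covers /posX /= -[nat_of_ord _]/(posU U'); lia.
Qed.

Lemma top_D5 U U' : U != U' -> top S U (Um U') = top S U (Up U').
Proof.
move=> UU'; have ne : posU U != posU U' by apply: contra_neq UU'; exact: posU_inj.
rewrite /top /posX /= -[nat_of_ord (val U')]/(posU U').
have -> : (posU U < (posU U').+1)%N = (posU U < posU U')%N by lia.
case: ifP => // _; congr (- (Posz _)); apply: eq_card => V1; rewrite !inE.
have := posU_neq_posV U' V1; lia.
Qed.

Lemma dots_D5 U U' s : U != U' ->
  ((U, s) \in dots S (Um U')) = ((U, s) \in dots S (Up U')).
Proof. by move=> h; rewrite !mem_dots /column_bottom ncover_D5 ?top_D5. Qed.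

Lemma top_Um U : top S U (Um U) = 0.
Proof.
rewrite /top /posX /= -[nat_of_ord (val U)]/(posU U) ltnn.
by rewrite eq_card0 // => V; rewrite !inE; apply/negP; lia.
Qed.

Lemma column_bottom_Up U : column_bottom U (Up U) = column_bottom U (Um U).
Proof.
rewrite /column_bottom top_Um /top /posX /= -[nat_of_ord (val U)]/(posU U) ltnSn.
by lia.
Qed.

Lemma column_bottom_Um_le0 U : column_bottom U (Um U) <= 0.
Proof. by rewrite /column_bottom top_Um; lia. Qed.

Lemma card_add1 (T : finType) (A B : pred T) (x : T) :
  {in predC1 x, A =1 B} -> ~~ B x -> #|A| = (A x + #|B|)%N.
Proof.
move=> AB Bx; rewrite (cardD1 x A) (cardD1 x B) -!topredE /= (negPf Bx) add0n.
apply/eqP; rewrite eqn_add2l; apply/eqP; apply: eq_card => y; rewrite !inE.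
by case: eqVneq => //= yx; rewrite -!topredE /= AB.
Qed.

Definition butterfly_ties U X : pred (D5 D * NS5 D) :=
  [pred p in ties S | (p.1 == U) && covers X p].

Lemma ncover_add1 U V X Y :
  (forall V', V' != V -> covers X (U, V') = covers Y (U, V')) ->
  covers X (U, V) -> ~~ covers Y (U, V) ->
  ncover S U X = (((U, V) \in ties S) + ncover S U Y)%N.
Proof.
move=> XY cX cY; rewrite -[ncover S U X]/#|butterfly_ties U X|.
rewrite -[ncover S U Y]/#|butterfly_ties U Y|.
rewrite (@card_add1 _ (butterfly_ties U X) (butterfly_ties U Y) (U, V)).
- have -> // : butterfly_ties U X (U, V) = ((U, V) \in ties S).
  by rewrite /butterfly_ties /= eqxx cX !andbT.
- move=> [U1 V1]; rewrite inE xpair_eqE /butterfly_ties /= => /nandP ne; congr (_ && _).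
  by case: (eqVneq U1 U) ne => [-> [//|V1V] | //]; rewrite XY.
- by rewrite /butterfly_ties /= eqxx (negPf cY) !andbF.
Qed.

Lemma ncover_right U V : (posU U < posV V)%N ->
  ncover S U (Vm V) = (((U, V) \in ties S) + ncover S U (Vp V))%N.
Proof.
move=> UV; apply: ncover_add1 => [V' V'V||].
- have : posV V' != posV V by apply: contra_neq V'V; exact: posV_inj.
  by rewrite /covers /posX /= -[nat_of_ord (val V)]/(posV V); lia.
- by rewrite /covers /posX /= -[nat_of_ord (val V)]/(posV V); lia.
- by rewrite /covers /posX /= -[nat_of_ord (val V)]/(posV V); lia.
Qed.

Lemma ncover_left U V : (posV V < posU U)%N ->
  ncover S U (Vp V) = (((U, V) \in ties S) + ncover S U (Vm V))%N.
Proof.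
move=> UV; apply: ncover_add1 => [V' V'V||].
- have : posV V' != posV V by apply: contra_neq V'V; exact: posV_inj.
  by rewrite /covers /posX /= -[nat_of_ord (val V)]/(posV V); lia.
- by rewrite /covers /posX /= -[nat_of_ord (val V)]/(posV V); lia.
- by rewrite /covers /posX /= -[nat_of_ord (val V)]/(posV V); lia.
Qed.

Lemma top_right U V : (posU U < posV V)%N -> top S U (Vp V) = top S U (Vm V).
Proof.
move=> UV; rewrite /top /posX /= -[nat_of_ord (val V)]/(posV V).
by rewrite UV ltnS (ltnW UV).
Qed.

Lemma top_left U V : (posV V < posU U)%N -> top S U (Vp V) = top S U (Vm V) + 1.
Proof.
move=> UV; rewrite /top /posX /= -[nat_of_ord (val V)]/(posV V).
rewrite ltnS leqNgt UV ltnNge (ltnW UV) /=.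
rewrite (@card_add1 _ [pred V1 : NS5 D | (posV V <= posV V1 < posU U)%N]
  [pred V1 : NS5 D | ((posV V).+1 <= posV V1 < posU U)%N] V) /=.
- by rewrite leqnn UV /= PoszD opprD addrAC addNr add0r.
- move=> V1; rewrite inE /= => V1V.
  have : posV V1 != posV V by apply: contra_neq V1V; exact: posV_inj.
  by lia.
- by rewrite ltnn.
Qed.

(** Crossing an NS5 brane from left to right raises each end of a column by
    [0] or [1]. This is all that the relations at NS5 branes use. *)
Lemma column_step U V :
  (top S U (Vm V) <= top S U (Vp V) <= top S U (Vm V) + 1) /\
  (column_bottom U (Vm V) <= column_bottom U (Vp V)
    <= column_bottom U (Vm V) + 1).
Proof.
rewrite /column_bottom; have := posU_neq_posV U V; rewrite neq_ltn => /orP [UV|UV].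
  by rewrite (ncover_right UV) (top_right UV); case: (_ \in ties S); lia.
by rewrite (ncover_left UV) (top_left UV); case: (_ \in ties S); lia.
Qed.

End Dots.

(** * Stability of the butterfly representation *)

Section Butterfly.
Variables (D : brane_diagram) (S : tie_diagram D) (R : realType).
Local Notation C := R[i].
Local Notation m_S := (butterfly_point S R).
Implicit Types (U : D5 D) (V : NS5 D) (X : D3 D) (p : D5 D * int).

(** The basis vector of a dot, extended by zero to all pairs: the matrices of
    the butterfly then act by formulas that hold for every pair. *)
Definition dot_vec X p : 'cV[C]_(mult X) := \col_i (dot S i == p)%:R.

Lemma dot_vec_out X p : p \notin dots S X -> dot_vec X p = 0.
Proof.
move=> pX; apply/colP => i; rewrite !mxE; case: eqP => // e.
by rewrite -e dot_mem in pX.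
Qed.

Lemma dot_vecE X (i : 'I_(mult X)) : dot_vec X (dot S i) = delta_mx i 0.
Proof.
by apply/colP => j; rewrite !mxE (inj_eq (@dot_inj D S X)) andbT.
Qed.

Lemma mul_dot_vec X k (M : 'M[C]_(k, mult X)) i : M *m dot_vec X (dot S i) = col i M.
Proof. by rewrite dot_vecE colE. Qed.

Lemma eq_on_dots X k (M N : 'M[C]_(k, mult X)) :
  (forall p, p \in dots S X -> M *m dot_vec X p = N *m dot_vec X p) -> M = N.
Proof.
move=> MN; apply/matrixP => i j.
by have /colP/(_ i) := MN _ (dot_mem S j); rewrite !mul_dot_vec !mxE.
Qed.

Lemma same_dotE X Y p :
  same_dot S R X Y *m dot_vec X p = (p \in dots S X)%:R *: dot_vec Y p.
Proof.
have [pX|pX] := boolP (p \in _); last by rewrite dot_vec_out // mulmx0 scale0r.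
have [i <-] := dot_onto pX; rewrite mul_dot_vec scale1r.
by apply/colP => j; rewrite !mxE.
Qed.

Lemma lower_dotE X Y U s : lower_dot S R X Y *m dot_vec X (U, s) =
  ((U, s) \in dots S X)%:R *: dot_vec Y (U, s - 1).
Proof.
have [pX|pX] := boolP (_ \in _); last by rewrite dot_vec_out // mulmx0 scale0r.
have [i e] := dot_onto pX; rewrite -e mul_dot_vec scale1r.
by apply/colP => j; rewrite !mxE e.
Qed.

Lemma mb_dotE U p :
  mb m_S U *m dot_vec (Up U) p = (- ((p == (U, 1)) && (p \in dots S (Up U)))%:R)%:M.
Proof.
have [pX|pX] := boolP (p \in _).
  have [i <-] := dot_onto pX; rewrite mul_dot_vec andbT.
  by apply/matrixP => k l; rewrite !ord1 !mxE.
by rewrite dot_vec_out // mulmx0 andbF oppr0 raddf0.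
Qed.

Lemma ma_dotE U : ma m_S U = dot_vec (Um U) (U, 0).
Proof. by []. Qed.

(** On both sides of an NS5 brane the composite of its two maps is the operator
    that lowers every dot by one step; the same operator is, up to sign, the
    endomorphism attached to a D5 brane, which gives all the moment map
    equations at D3 branes. *)
Lemma mulCD_butterfly V :
  mC m_S V *m mD m_S V = lower_dot S R (Vm V) (Vm V).
Proof.
apply: eq_on_dots => -[U s] pX; rewrite -mulmxA same_dotE lower_dotE pX !scale1r.
rewrite lower_dotE; have [|pV] := boolP (_ \in _); first by rewrite scale1r.
rewrite scale0r dot_vec_out //; move: pX pV; rewrite !mem_dots.
by have := column_step S U V; lia.
Qed.

Lemma mulDC_butterfly V :
  mD m_S V *m mC m_S V = lower_dot S R (Vp V) (Vp V).
Proof.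
apply: eq_on_dots => -[U s] pX; rewrite -mulmxA !lower_dotE pX !scale1r.
rewrite same_dotE; have [|pV] := boolP (_ \in _); first by rewrite scale1r.
rewrite scale0r dot_vec_out //; move: pX pV; rewrite !mem_dots.
by have := column_step S U V; lia.
Qed.

(** The two composites agree on every dot except the one at height [1] in the
    butterfly of [U]: lowering it first gives the dot at height [0] below
    [U^-], which the term with [ma] and [mb] cancels. *)
Lemma butterfly_triangle U : mB m_S U *m mA m_S U - mA m_S U *m mB' m_S U
  + ma m_S U *m mb m_S U = 0.
Proof.
apply: eq_on_dots => -[U' s] pX; rewrite mul0mx mulmxDl mulmxBl -!mulmxA.
rewrite mb_dotE mul_mx_scalar ma_dotE /= same_dotE pX scale1r andbT.
rewrite !mulNmx !mulmxN !lower_dotE pX scale1r same_dotE opprK.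
have [e|U'U] := eqVneq U' U; last first.
  rewrite xpair_eqE (negPf U'U) /= oppr0 scale0r addr0 dots_D5 // pX scale1r.
  have [|pV] := boolP (_ \in _); first by rewrite scale1r addNr.
  by rewrite -dots_D5 // in pV; rewrite dot_vec_out // scaler0 addr0 oppr0.
subst U'; rewrite xpair_eqE eqxx /= scaleNr.
move: pX; rewrite !mem_dots column_bottom_Up top_Um => pX.
have [e|s1] := eqVneq s 1.
  rewrite e in pX *; rewrite subrr (_ : (_ < 1 <= 0) = false); last by lia.
  rewrite scale0r oppr0 add0r scale1r.
  have [|b0] := boolP (_ < 0 <= _); first by rewrite scale1r subrr.
  rewrite scale0r dot_vec_out ?oppr0 ?addr0 // mem_dots top_Um.
  by move: pX b0; lia.
rewrite scale0r subr0; have [s0|s0] := boolP (s <= 0).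
  case/andP: (pX) => -> _; rewrite scale1r.
  have [|b0] := boolP (_ < s - 1 <= _); first by rewrite scale1r addNr.
  rewrite dot_vec_out ?scaler0 ?oppr0 ?addr0 // mem_dots top_Um.
  by move: pX b0; lia.
rewrite andbF scale0r oppr0 add0r.
by rewrite dot_vec_out ?scaler0 // mem_dots top_Um; lia.
Qed.

Lemma butterfly_moment : moment_zero m_S.
Proof.
split=> [U | k h h' | k h h' | k h h' | k h h'].
- exact: butterfly_triangle.
- apply/eqP; rewrite subr_eq0; apply/eqP; congr (- _).
  exact: (gauge_irr (fun X => lower_dot S R X X)).
- rewrite mulCD_butterfly mulDC_butterfly; apply/eqP; rewrite subr_eq0.
  apply/eqP; exact: (gauge_irr (fun X => lower_dot S R X X)).
- rewrite mulDC_butterfly /= opprK addrC; apply/eqP; rewrite subr_eq0.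
  apply/eqP; exact: (gauge_irr (fun X => lower_dot S R X X)).
- rewrite mulCD_butterfly /=; apply/eqP; rewrite subr_eq0.
  apply/eqP; exact: (gauge_irr (fun X => lower_dot S R X X)).
Qed.

(** A vector killed by [mA] only involves the dots at positive heights in the
    butterfly of [U], and lowering brings each of them to height [1], where
    [mb] sees it. *)
Lemma butterfly_S1 U : S1 m_S U.
Proof.
move=> T TB TA Tb; apply/eqP; rewrite -subv0; apply/subvP => v vT.
rewrite memv0; apply/eqP/colP => i; rewrite [RHS]mxE.
(* a dot of [U^+] is either seen by [mA] or lies above the base level in the
   butterfly of [U] *)
have [iUm|iUm] := boolP (dot S i \in dots S (Um U)).
  have [j ej] := dot_onto iUm.
  have /colP/(_ j) := TA _ vT; rewrite !mxE (bigD1 i) //= mxE ej eqxx mul1r.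
  rewrite big1 ?addr0 // => k ki; rewrite mxE ej (inj_eq (@dot_inj D S _)).
  by rewrite eq_sym (negPf ki) mul0r.
have Ui : (dot S i).1 = U.
  apply/eqP; apply: contraNT iUm => /dots_D5 h.
  by rewrite [dot S i]surjective_pairing h -surjective_pairing dot_mem.
have : exists n : nat, dot S i = (U, n%:Z + 1).
  have := dot_mem S i; move: iUm; rewrite [dot S i]surjective_pairing Ui.
  rewrite !mem_dots column_bottom_Up top_Um => h1 h2.
  by exists `|(dot S i).2 - 1|%N; congr (_, _); lia.
(* induction on the number of steps needed to reach height [1] *)
case=> n; elim: n i {iUm Ui} v vT => [|n IH] i v vT ei.
  have /rowP/(_ 0) := Tb _ vT; rewrite !mxE (bigD1 i) //= mxE ei add0r eqxx.
  rewrite big1 ?addr0 => [|k ki]; first by rewrite mulN1r => /eqP; rewrite oppr_eq0 => /eqP.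
  rewrite mxE -[(U, 1)]/(U, 0%:Z + 1) -ei (inj_eq (@dot_inj D S _)).
  by rewrite (negPf ki) oppr0 mul0r.
have [j ej] : exists j : 'I_(mult (Up U)), dot S j = (U, n%:Z + 1).
  apply: dot_onto; have := dot_mem S i; rewrite ei !mem_dots column_bottom_Up.
  by have := column_bottom_Um_le0 S U; lia.
have := IH j _ (TB _ vT) ej; rewrite !mxE (bigD1 i) //= !mxE ei ej.
rewrite (_ : (n.+1%:Z + 1 - 1 = n%:Z + 1)) ?eqxx; last by lia.
rewrite big1 ?addr0 => [|k ki]; first by rewrite mulN1r => /eqP; rewrite oppr_eq0 => /eqP.
rewrite !mxE ej (_ : _ == _ = false) ?oppr0 ?mul0r //.
apply: contraNF ki => /eqP [eU es]; apply/eqP; apply: (@dot_inj D S).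
by rewrite ei [dot S k]surjective_pairing -eU; congr (_, _); move: es; lia.
Qed.

(** Below [U^-], the dots of the other butterflies are in the image of [mA], and
    those of the butterfly of [U] are obtained by lowering its top dot, the
    image of [ma]. *)
Lemma butterfly_S2 U : S2 m_S U.
Proof.
move=> T TB TAa; apply/eqP; rewrite eqEsubv subvf; apply/subvP => v _.
have TA w : mA m_S U *m w \in T by have := TAa w 0; rewrite mulmx0 addr0.
have Ta : ma m_S U \in T.
  by have := TAa 0 1%:M; rewrite mulmx0 add0r mulmx1.
suff Td p : p \in dots S (Um U) -> dot_vec (Um U) p \in T.
  rewrite [v]matrix_sum_delta; apply: memv_suml => i _; apply: memv_suml => j _.
  by rewrite memvZ // (ord1 j) -dot_vecE Td ?dot_mem.
case: p => U' s; have [->|U'U] := eqVneq U' U; last first.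
  move=> pX; have := TA (dot_vec (Up U) (U', s)).
  by rewrite /= same_dotE -dots_D5 // pX scale1r.
move=> pX; have : exists n : nat, s = - n%:Z.
  by move: pX; rewrite mem_dots top_Um => h; exists `|s|%N; lia.
case=> n sn; move: pX; rewrite {}sn; elim: n => [|n IH] pX; first exact: Ta.
have pn : (U, - n%:Z) \in dots S (Um U) by move: pX; rewrite !mem_dots top_Um; lia.
have := TB _ (IH pn); rewrite /= mulNmx lower_dotE pn scale1r memvN.
by congr (dot_vec _ (_, _) \in T); lia.
Qed.

Lemma butterfly_Mtilde : Mtilde m_S.
Proof.
split; first exact: butterfly_moment.
by move=> U; split; [exact: butterfly_S1 | exact: butterfly_S2].
Qed.

Definition butterfly_proj U X : 'M[C]_(mult X) :=
  \matrix_(i, j) ((dot S i == dot S j) && ((dot S j).1 == U))%:R.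

Lemma butterfly_projE U X p :
  butterfly_proj U X *m dot_vec X p = (p.1 == U)%:R *: dot_vec X p.
Proof.
have [pX|pX] := boolP (p \in dots S X); last by rewrite dot_vec_out // mulmx0 scaler0.
have [i <-] := dot_onto pX; rewrite mul_dot_vec.
by apply/colP => j; rewrite !mxE -natrM mulnb andbC.
Qed.

Lemma butterfly_proj_eq0 U X k (M : 'M[C]_(k, mult X)) :
  M *m butterfly_proj U X = 0 <-> forall s, M *m dot_vec X (U, s) = 0.
Proof.
split=> [M0 s | M0].
  have : M *m butterfly_proj U X *m dot_vec X (U, s) = 0 by rewrite M0 mul0mx.
  by rewrite -mulmxA butterfly_projE eqxx scale1r.
apply: eq_on_dots => -[U' s] _; rewrite mul0mx -mulmxA butterfly_projE /=.
by case: eqVneq => [->|_]; rewrite ?scale1r ?scale0r ?mulmx0.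
Qed.

(** A morphism with [lam = 0] vanishes on the whole butterfly of [U]. It kills
    the top dot below [U^-], hence the column below [U^-], hence the left wing,
    whose dots are all obtained from that column by [mA] and [mC]. To the right
    of a D5 brane the dots are not images but preimages, and it is (S1) for the
    target that lets the vanishing cross it; an NS5 brane of the right wing is
    crossed by [mD], which is surjective there. *)
Section Rigid.
Variables (m : rep R D) (psi : forall X : D3 D, 'M[C]_(mult X)).
Hypothesis S1m : forall U, S1 m U.
Hypothesis psi_mor : morphism 0 psi m_S m.

(** The image of the column below [U'^+] is invariant and killed by [mA] and
    [mb] in the target. *)
Lemma vanish_cross U U' : (forall s, psi (Um U') *m dot_vec (Um U') (U, s) = 0) ->
  forall s, psi (Up U') *m dot_vec (Up U') (U, s) = 0.
Proof.
case: psi_mor => hA hb _ _ hB' _ _ psi0; apply/butterfly_proj_eq0.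
apply: (S1_mx (L := mB' m_S U') (@S1m U')).
- rewrite mulmxA -hB' -!mulmxA; congr (_ *m _).
  apply: eq_on_dots => -[U1 s] pX; rewrite /= -!mulmxA butterfly_projE /=.
  rewrite -scalemxAr mulNmx lower_dotE mulmxN -scalemxAr butterfly_projE.
  by rewrite scalerN !scalerA mulrC.
- rewrite mulmxA -hA; apply/butterfly_proj_eq0 => s.
  by rewrite -mulmxA same_dotE -scalemxAr psi0 scaler0.
- by rewrite mulmxA hb scale0r mul0mx.
Qed.

Lemma vanish_Um U s : psi (Um U) *m dot_vec (Um U) (U, s) = 0.
Proof.
case: psi_mor => _ _ ha hB _ _ _.
have [pX|pX] := boolP ((U, s) \in dots S (Um U)); last by rewrite dot_vec_out ?mulmx0.
have : exists n : nat, s = - n%:Z.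
  by move: pX; rewrite mem_dots top_Um => h; exists `|s|%N; lia.
case=> n sn; move: pX; rewrite {}sn; elim: n => [|n IH] pX.
  by have := ha U; rewrite scale0r.
have pn : (U, - n%:Z) \in dots S (Um U) by move: pX; rewrite !mem_dots top_Um; lia.
have := congr1 (fun M => M *m dot_vec (Um U) (U, - n%:Z)) (hB U).
rewrite -!mulmxA IH // mulmx0 mulNmx mulmxN lower_dotE pn scale1r => /eqP.
rewrite oppr_eq0 => /eqP <-; congr (_ *m dot_vec _ (_, _)); lia.
Qed.

Lemma vanish_left U k (hk : (k < (size (branes D)).+1)%N) : (k <= posU U)%N ->
  forall s, psi (Ordinal hk) *m dot_vec (Ordinal hk) (U, s) = 0.
Proof.
case: psi_mor => hA _ _ _ _ hC _.
move=> kU; have [n en] : exists n, (posU U = k + n)%N by exists (posU U - k)%N; lia.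
elim: n k hk kU en => [|n IH] k hk kU en s.
  have -> : Ordinal hk = Um U by apply: val_inj; rewrite /= -[LHS]addn0 -en.
  exact: vanish_Um.
have kN : (k < size (branes D))%N by have := ltn_ord (val U); rewrite -/(posU U); lia.
have {}IH h s' : psi (Ordinal h) *m dot_vec (Ordinal (h : (k.+1 < _)%N)) (U, s') = 0.
  by apply: IH; lia.
have [pX|pX] := boolP ((U, s) \in dots S (Ordinal hk)); last by rewrite dot_vec_out ?mulmx0.
have [kD5|kNS5] := brane_cases kN.
- pose U' := mkD5 kD5.
  have ek : Ordinal hk = Um U' by apply: val_inj.
  have UU' : U != U' by apply/eqP => e; move: en; rewrite e /posU /=; lia.
  rewrite ek in pX *.
  have := congr1 (fun M => M *m dot_vec (Up U') (U, s)) (hA U').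
  by rewrite -!mulmxA IH mulmx0 same_dotE -dots_D5 // pX scale1r.
- pose V := mkNS5 kNS5.
  have ek : Ordinal hk = Vm V by apply: val_inj.
  have VU : (posV V < posU U)%N by rewrite en /posV /=; lia.
  rewrite ek in pX *.
  have := congr1 (fun M => M *m dot_vec (Vp V) (U, s + 1)) (hC V).
  rewrite -!mulmxA IH mulmx0 lower_dotE addrK.
  rewrite (_ : (U, s + 1) \in _) ?scale1r //; move: pX; rewrite !mem_dots.
  by have := column_step S U V; have := top_left S VU; lia.
Qed.

Lemma vanish_right U k (hk : (k < (size (branes D)).+1)%N) : (posU U < k)%N ->
  forall s, psi (Ordinal hk) *m dot_vec (Ordinal hk) (U, s) = 0.
Proof.
case: psi_mor => _ _ _ _ _ _ hD.
elim: k hk => // k IH hk kU s.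
have [e|ne] := eqVneq k (posU U).
  have -> : Ordinal hk = Up U by apply: val_inj; rewrite /= e.
  exact: vanish_cross (vanish_Um U) s.
have {}IH h s' : psi (Ordinal h) *m dot_vec (Ordinal (h : (k < _)%N)) (U, s') = 0.
  by apply: IH; lia.
have [kD5|kNS5] := brane_cases (hk : (k < size (branes D))%N).
- have -> : Ordinal hk = Up (mkD5 kD5) by apply: val_inj.
  by apply: vanish_cross => s'; exact: IH.
- pose V := mkNS5 kNS5.
  have -> : Ordinal hk = Vp V by apply: val_inj.
  have UV : (posU U < posV V)%N by rewrite /posV /=; lia.
  have [pX|pX] := boolP ((U, s) \in dots S (Vp V)); last by rewrite dot_vec_out ?mulmx0.
  have := congr1 (fun M => M *m dot_vec (Vm V) (U, s)) (hD V).
  rewrite -!mulmxA IH mulmx0 same_dotE.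
  rewrite (_ : (U, s) \in _) ?scale1r //; move: pX; rewrite !mem_dots.
  by have := column_step S U V; have := top_right S UV; lia.
Qed.

End Rigid.

Lemma butterfly_rigid : rigid m_S.
Proof.
move=> m psi S1m psi_mor [k hk]; apply: eq_on_dots => -[U s] _; rewrite mul0mx.
by case: (leqP k (posU U)) => kU;
  [exact: (vanish_left psi_mor) | exact: (vanish_right S1m psi_mor)].
Qed.

Lemma butterfly_stable : stable m_S.
Proof.
split=> [|z z0]; first exact: butterfly_Mtilde.
split; first exact: orbit_closed butterfly_Mtilde butterfly_rigid z0.
apply: (sub_finite_set (B := [set (fun=> 1%:M)])); last exact: finite_set1.
move=> g [ug /(congr1 fst) gm].
exact: (rigid_free (@butterfly_S1) butterfly_rigid ug gm).
Qed.

End Butterfly.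

(** * Torus action on orbits and on the tautological bundle *)

Section Classes.
Variables (R : realType) (D : brane_diagram).
Local Notation C := R[i].
Implicit Types (m : rep R D) (g h : forall X : D3 D, 'M[C]_(mult X)) (t : torus R D).

Lemma torus_gauge_act t g m :
  torus_act t (gauge_act g m) = gauge_act g (torus_act t m).
Proof.
by apply: rep_ext => W //=; rewrite -?scalemxAr -?scalemxAl -?scalemxAr.
Qed.

Lemma taut_class_mem X m (w : 'cV[C]_(mult X)) : taut_class (m, w) (m, w).
Proof.
exists (fun X => 1%:M); first exact: gauge_group1.
by rewrite /= gauge_act1 mul1mx.
Qed.

Lemma taut_class_gauge X g m (w : 'cV[C]_(mult X)) : gauge_group g ->
  taut_class (gauge_act g m, g X *m w) = taut_class (m, w).
Proof.
move=> ug; apply/seteqP; split=> _ [h uh <-] /=.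
  exists (fun X => h X *m g X); first exact: gauge_group_mul.
  by rewrite /= gauge_actM // mulmxA.
exists (fun X => h X *m invmx (g X)).
  by apply: gauge_group_mul => //; exact: gauge_group_inv.
rewrite /= mulmxA mulmxKV // gauge_actM //.
  by congr (gauge_act _ _, _); apply: functional_extensionality_dep => Y; rewrite mulmxKV.
by apply: gauge_group_mul => //; exact: gauge_group_inv.
Qed.

Lemma taut_projE X m (w : 'cV[C]_(mult X)) : taut_proj (taut_class (m, w)) = bow_class m.
Proof.
apply/seteqP; split=> [_ [_ [g ug <-] <-] | _ [g ug <-]] /=; first by exists g.
by exists (gauge_act g m, g X *m w) => //; exists g.
Qed.

Lemma bow_class_mem m : bow_class m m.
Proof.
by exists (fun X => 1%:M); [exact: gauge_group1 | exact: gauge_act1].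
Qed.

Lemma bow_class_gauge g m : gauge_group g -> bow_class (gauge_act g m) = bow_class m.
Proof.
move=> ug; apply/seteqP; split=> _ [h uh <-].
  by exists (fun X => h X *m g X); [exact: gauge_group_mul | rewrite gauge_actM].
exists (fun X => h X *m invmx (g X)).
  by apply: gauge_group_mul => //; exact: gauge_group_inv.
by rewrite -gauge_actM ?gauge_actV //; exact: gauge_group_inv.
Qed.

Lemma torus_act_bow_class t m :
  torus_act_bow t (bow_class m) = bow_class (torus_act t m).
Proof.
apply/seteqP; split=> [_ [_ [g ug <-] <-] | _ [g ug <-]].
  by exists g => //; rewrite torus_gauge_act.
by exists (gauge_act g m); [exists g | exact: torus_gauge_act].
Qed.

Lemma torus_act_taut_class X t m (w : 'cV[C]_(mult X)) :
  torus_act_taut t (taut_class (m, w)) = taut_class (torus_act t m, w).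
Proof.
apply/seteqP; split=> [_ [_ [g ug <-] <-] | _ [g ug <-]] /=.
  by exists g => //=; rewrite torus_gauge_act.
exists (gauge_act g m, g X *m w); first by exists g.
by rewrite /= torus_gauge_act.
Qed.

(** When the stabilizer of [m] is trivial, every element of the fibre has a
    unique representative over [m], which identifies the fibre with [W_X]. If
    the torus moves [m] as the gauge transformation [gam] does, then restoring
    the representative [m] acts on the vector by the inverse [rho] of [gam]. *)
Lemma taut_frame_class X m (rho gam : torus R D -> forall X : D3 D, 'M[C]_(mult X)) :
  stable m ->
  (forall g, gauge_group g -> gauge_act g m = m -> g = fun=> 1%:M) ->
  (forall t, gauge_group (gam t)) ->
  (forall t X, gam t X *m rho t X = 1%:M) ->
  (forall t, torus_act t m = gauge_act (gam t) m) ->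
  taut_frame (X := X) (bow_class m) (fun w => taut_class (m, w)) (fun t => rho t X).
Proof.
move=> st free ugam gamK tm.
have memE g v w : gauge_group g ->
    taut_class (m, w) (gauge_act g m, v) -> v = g X *m w.
  move=> ug [h uh e].
  have hg : gauge_act h m = gauge_act g m := congr1 fst e.
  have <- : h X *m w = v := congr1 snd e.
  have uV := gauge_group_inv ug.
  suff -> : h = g by [].
  have /(congr1 (fun k => fun X => g X *m k X)) :
      (fun X => invmx (g X) *m h X) = fun=> 1%:M.
    apply: free; first exact: gauge_group_mul.
    by rewrite -gauge_actM // hg gauge_actV.
  move=> hgE; apply: functional_extensionality_dep => Y.
  have /(congr1 (fun k => k Y)) /= := hgE.
  by rewrite mulKVmx // mulmx1.
split.
- split=> [w _ | v w _ _ vw | e [[[n w] [sn _] <-]]].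
  + by split; [exists (m, w) | exact: taut_projE].
  + have : taut_class (m, w) (m, v) by rewrite -vw; exact: taut_class_mem.
    rewrite -{2}(gauge_act1 m) => /memE ->; last exact: gauge_group1.
    by rewrite mul1mx.
  + rewrite /= taut_projE => nm.
    have : bow_class n m by rewrite nm; exact: bow_class_mem.
    case=> g ug gn; exists (g X *m w) => //.
    by rewrite -gn taut_class_gauge.
- move=> v w; apply/seteqP; split=> [_ [g ug <-] | [n x] /= [v' [w' [nv nw xvw]]]] /=.
    exists (g X *m v), (g X *m w); split; try by exists g.
    by rewrite mulmxDr.
  move: xvw nv nw => /= -> [g ug e].
  have <- : gauge_act g m = n := congr1 fst e.
  have <- : g X *m v = v' := congr1 snd e.
  by move=> /(memE _ _ _ ug) ->; exists g => //=; rewrite mulmxDr.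
- move=> c v; apply/seteqP; split=> [_ [g ug <-] | _ [_ [g ug <-] <-]] /=.
    by exists (gauge_act g m, g X *m v); [exists g | rewrite /= scalemxAr].
  by exists g => //=; rewrite scalemxAr.
- move=> t v; rewrite torus_act_taut_class tm.
  rewrite -[v in LHS]mul1mx -(gamK t X) -mulmxA.
  exact: taut_class_gauge.
Qed.

End Classes.

(** * Weights of the butterfly representation *)

Section Weights.
Variables (D : brane_diagram) (S : tie_diagram D) (R : realType).
Local Notation C := R[i].
Local Notation m_S := (butterfly_point S R).

Lemma monomial_neq0 p (t : torus R D) : monomial R p t != 0.
Proof. by rewrite mulf_neq0 ?tu_neq0 // expfz_neq0 // th_neq0. Qed.

Definition weight_mx (t : torus R D) (X : D3 D) : 'M[C]_(mult X) :=
  diag_mx (\row_j monomial R (dot S j) t).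

Definition weight_gauge (t : torus R D) (X : D3 D) : 'M[C]_(mult X) :=
  diag_mx (\row_j (monomial R (dot S j) t)^-1).

Lemma weight_gaugeK t X : weight_gauge t X *m weight_mx t X = 1%:M.
Proof.
rewrite mulmx_diag -diag_const_mx; congr diag_mx.
by apply/rowP => j; rewrite !mxE mulVf // monomial_neq0.
Qed.

Lemma weight_gauge_unit t : gauge_group (weight_gauge t).
Proof. by move=> X; case: (mulmx1_unit (weight_gaugeK t X)). Qed.

(** Each map of the butterfly sends a dot to a dot, and the ratio of their
    monomials is the factor by which the torus scales that map. *)
Lemma torus_act_butterfly t : torus_act t m_S = gauge_act (weight_gauge t) m_S.
Proof.
have ut U := tu_neq0 t U; have ht := th_neq0 t.
symmetry; apply: morphism_gauge_act; first exact: weight_gauge_unit.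
have lowerP U s : (monomial R (U, s - 1) t)^-1 =
    th t * (monomial R (U, s) t)^-1.
  by rewrite /monomial /= expfzDr // exprN1; field; rewrite ut ht expfz_neq0.
split=> W /=; rewrite ?scale1r ?mul_diag_mx ?mul_mx_diag.
- apply/matrixP => i j; rewrite !mxE.
  by case: eqP => [->|_]; rewrite ?mulr0 ?mul0r // mulr1 mul1r.
- apply/matrixP => i j; rewrite !mxE.
  case: eqP => [->|_]; last by rewrite oppr0 mulr0 mul0r.
  rewrite /monomial /= expr1z mulrN mulr1 mulNr [th t * _]mulrC mulfV //.
  by rewrite mulf_neq0.
- apply/matrixP => i j; rewrite !mxE.
  case: eqP => [->|_]; last by rewrite !mulr0.
  by rewrite /monomial /= expr0z !mulr1.
- apply/matrixP => i j; rewrite !mxE.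
  case: eqP => [->|_]; last by rewrite oppr0 !mulr0 mul0r.
  by rewrite lowerP -surjective_pairing; ring.
- apply/matrixP => i j; rewrite !mxE.
  case: eqP => [->|_]; last by rewrite oppr0 !mulr0 mul0r.
  by rewrite lowerP -surjective_pairing; ring.
- apply/matrixP => i j; rewrite !mxE.
  case: eqP => [->|_]; last by rewrite !mulr0 mul0r.
  by rewrite lowerP -surjective_pairing; ring.
- apply/matrixP => i j; rewrite !mxE.
  by case: eqP => [->|_]; rewrite ?mulr0 ?mul0r // mulr1 mul1r.
Qed.

Lemma big_dots (T : Type) (idx : T) (op : T -> T -> T) X (F : D5 D * int -> T) :
  \big[op/idx]_(p <- dots S X) F p = \big[op/idx]_(i < mult X) F (dot S i).
Proof. exact: (big_tuple _ _ (Tuple (size_dots S X))). Qed.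

Lemma weight_roots X :
  KT_roots (fun t => weight_mx t X) [seq monomial R p | p <- dots S X].
Proof.
move=> t; rewrite big_map big_dots char_poly_trig ?diag_mx_is_trig //.
by apply: eq_bigr => i _; rewrite !mxE eqxx mulr1n.
Qed.

Lemma weight_trace X :
  KT_class (fun t => weight_mx t X) = \sum_(p <- dots S X) monomial R p.
Proof.
rewrite fct_sumE; apply/funext => t; rewrite big_dots /KT_class mxtrace_diag.
by apply: eq_bigr => i _; rewrite mxE.
Qed.

End Weights.

Theorem theorem4p10 (R : realType) (D : brane_diagram) (S : tie_diagram D)
    (X : D3 D) :
  bow_fixed (fixed_point S R) /\
  exists rho : torus R D -> 'M[R[i]]_(mult X),
    [/\ taut_restriction X (fixed_point S R) rho,
        KT_roots rho [seq monomial R p | p <- dots S X]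
      & KT_class rho = \sum_(p <- dots S X) monomial R p].
Proof.
split.
  split=> [|t]; first by exists (butterfly_point S R) => //; exact: butterfly_stable.
  rewrite torus_act_bow_class torus_act_butterfly bow_class_gauge //.
  exact: weight_gauge_unit.
exists (fun t => weight_mx S t X); split.
- exists (fun w => taut_class (butterfly_point S R, w)).
  apply: (@taut_frame_class R D X _ (@weight_mx D S R) (@weight_gauge D S R)).
  + exact: butterfly_stable.
  + move=> g; exact: rigid_free (@butterfly_S1 D S R) (@butterfly_rigid D S R).
  + exact: weight_gauge_unit.
  + exact: weight_gaugeK.
  + exact: torus_act_butterfly.
- exact: weight_roots.
- exact: weight_trace.
Qed.
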